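(* Let a robust two-stage combinatorial optimization problem $\textsc{Rob}$ with two-stage continuous budgeted uncertainty on $n$ items be given, with nominal feasible set $\mathcal{X}_{\rm nom}=\{x\in\{0,1\}^n: Ax\ge b\}$. Suppose that the polyhedron $P=\{x\in[0,1]^n: Ax\ge b\}$ is integral. Then a solution to the robust problem $\textsc{Rob}$ can be obtained by taking the minimum of the objective values of - $O(n^2)$ many problems of nominal type, and - $O(n^3)$ many problems of type (T). In particular, if problems of type (T) can be solved in polynomial time, so can the robust problem.
   Context: Notation: $[n]=\{1,\dots,n\}$ and $\min\emptyset=\infty$. Nominal data: $A\in\mathbb{R}^{m\times n}$, $b\in\mathbb{R}^m$, $\mathcal{X}_{\rm nom}=\{x\in\{0,1\}^n: Ax\ge b\}$. A problem of nominal type is $\min_{x\in\mathcal{X}_{\rm nom}} v^t x + M$ for a cost vector $v\in\mathbb{R}^n$ and a constant $M$. Put $\mathcal{X}=\{0,1\}^n$ and, for $x\in\mathcal{X}$, $\mathcal{X}(x)=\{y\in\{0,1\}^n: A(x+y)\ge b,\ x+y\le \mathbf{1}\}$. Two-stage continuous budgeted uncertainty: given $0\le\underline{c}_i\le\overline{c}_i$, $0\le\underline{d}_i\le\overline{d}_i$ ($i\in[n]$) and $\Gamma\ge0$, $$\mathcal{U}=\{c\in\mathbb{R}^n_+: c_i=\underline{c}_i+(\overline{c}_i-\underline{c}_i)\delta_i,\ \delta_i\in[0,1]\ \forall i\in[n],\ \textstyle\sum_{i}\delta_i\le\Gamma\},$$ $$\mathcal{U}(c)=\{d\in\mathbb{R}^n_+: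 d_i=\underline{d}_i+(\overline{d}_i-\underline{d}_i)\delta_i,\ \delta_i\in[0,1]\ \forall i\in[n],\ \textstyle\sum_i\delta_i\le\Gamma-\sum_{i}\frac{c_i-\underline{c}_i}{\overline{c}_i-\underline{c}_i}\},$$ where a fraction with $\overline{c}_i=\underline{c}_i$ is read as $0$. The robust problem is $$\textsc{Rob}=\min_{x\in\mathcal{X}}\max_{c\in\mathcal{U}}\min_{y\in\mathcal{X}(x)}\max_{d\in\mathcal{U}(c)} c^tx+d^ty .$$ A problem of type (T) is, for constants $\tilde a,\tilde b,\tilde c\in\mathbb{R}^n_+$ and $\tilde v\ge0$, $$\min\ \tilde a^tx+\tilde b^ty^{(1)}+\tilde c^ty^{(2)}+\tilde v$$ subject to $A(x+y^{(1)})\ge b$, $A(x+y^{(2)})\ge b$, $x+y^{(1)}\le\mathbf{1}$, $x+y^{(2)}\le\mathbf{1}$, $x,y^{(1)},y^{(2)}\in\{0,1\}^n$. (The matrix $A$ and vector $b$ are those of the nominal problem.) *)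

(* Defs.v *)
(* MathComp / MathComp-Analysis development. *)
From HB Require Import structures.
From mathcomp Require Import all_boot all_order all_algebra.
From mathcomp Require Import all_classical all_reals ereal.

Set Implicit Arguments.
Unset Strict Implicit.
Unset Printing Implicit Defensive.
Import Order.TTheory GRing.Theory Num.Theory.

Local Open Scope classical_set_scope.
Local Open Scope ring_scope.

(** * Nominal problems *)

Definition lev (R : numDomainType) n (u v : 'cV[R]_n) : Prop :=
  forall i, u i 0 <= v i 0.

Definition dot (R : numDomainType) n (u v : 'cV[R]_n) : R :=
  \sum_i u i 0 * v i 0.

Definition binary (R : numDomainType) n : set 'cV[R]_n :=
  [set x : 'cV[R]_n | forall i, x i 0 = 0 \/ x i 0 = 1].

Record nominal (R : Type) (n : nat) := Nominal {
  nrows : nat;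
  nmx : 'M[R]_(nrows, n);
  nrhs : 'cV[R]_nrows }.

Definition satisfies (R : numDomainType) n (N : nominal R n) (z : 'cV[R]_n) :=
  lev (nrhs N) (nmx N *m z).

Definition nominal_set (R : numDomainType) n (N : nominal R n) : set 'cV[R]_n :=
  [set x : 'cV[R]_n | binary x /\ satisfies N x].

(* All optimal values live in \bar R and are infima or suprema.  The minima
   range over finite sets, so they are attained unless the set is empty, in
   which case the infimum is +oo. *)
Definition nominal_value (R : realType) n (N : nominal R n)
    (vM : 'cV[R]_n * R) : \bar R :=
  ereal_inf [set (dot vM.1 x + vM.2)%:E | x in nominal_set N].

Definition relaxation (R : numDomainType) n (N : nominal R n) : set 'cV[R]_n :=
  [set x : 'cV[R]_n | (forall i, 0 <= x i 0 <= 1) /\ satisfies N x].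

Definition convex_hull (R : numDomainType) n (S : set 'cV[R]_n) :
    set 'cV[R]_n :=
  [set x : 'cV[R]_n | exists k (z : 'I_k -> 'cV[R]_n) (w : 'I_k -> R),
    [/\ forall j, S (z j), forall j, 0 <= w j, \sum_j w j = 1
      & x = \sum_j w j *: z j]].

(* A polyhedron is integral if it is the convex hull of its integral points. *)
Definition is_integral (R : archiNumDomainType) n (S : set 'cV[R]_n) : Prop :=
  S = convex_hull (S `&` [set z : 'cV[R]_n | forall i, z i 0 \is a Num.int]).

(** * The robust problem *)

Record budgeted (R : Type) (n : nat) := Budgeted {
  c_lo : 'cV[R]_n; c_up : 'cV[R]_n;
  d_lo : 'cV[R]_n; d_up : 'cV[R]_n;
  budget : R }.

Definition budgeted_valid (R : numDomainType) n (u : budgeted R n) : Prop :=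
  [/\ forall i, 0 <= c_lo u i 0 <= c_up u i 0,
      forall i, 0 <= d_lo u i 0 <= d_up u i 0
    & 0 <= budget u].

Definition uncertainty (R : numDomainType) n (lo up : 'cV[R]_n) (G : R) :
    set 'cV[R]_n :=
  [set c : 'cV[R]_n | (forall i, 0 <= c i 0) /\
    exists delta : 'I_n -> R,
      [/\ forall i, c i 0 = lo i 0 + (up i 0 - lo i 0) * delta i,
          forall i, 0 <= delta i <= 1
        & \sum_i delta i <= G]].

Definition first_uncertainty (R : numDomainType) n (u : budgeted R n) :=
  uncertainty (c_lo u) (c_up u) (budget u).

(* The terms with c_up = c_lo vanish, since x / 0 = 0. *)
Definition second_uncertainty (R : numFieldType) n (u : budgeted R n)
    (c : 'cV[R]_n) :=
  uncertainty (d_lo u) (d_up u)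
    (budget u - \sum_i (c i 0 - c_lo u i 0) / (c_up u i 0 - c_lo u i 0)).

Definition second_stage (R : numDomainType) n (N : nominal R n)
    (x : 'cV[R]_n) : set 'cV[R]_n :=
  [set y : 'cV[R]_n |
    [/\ binary y, satisfies N (x + y) & lev (x + y) (const_mx 1)]].

(* Worst-case cost of the first-stage decision x. *)
Definition worst_cost (R : realType) n (N : nominal R n) (u : budgeted R n)
    (x : 'cV[R]_n) : \bar R :=
  ereal_sup [set
    ereal_inf [set
      ereal_sup [set (dot c x + dot d y)%:E | d in second_uncertainty u c]
    | y in second_stage N x]
  | c in first_uncertainty u].

Definition robust_value (R : realType) n (N : nominal R n) (u : budgeted R n) :
    \bar R :=
  ereal_inf [set worst_cost N u x | x in @binary R n].

(** * Problems of type (T) *)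

Record typeT (R : Type) (n : nat) := TypeT {
  t_a : 'cV[R]_n; t_b : 'cV[R]_n; t_c : 'cV[R]_n; t_v : R }.

Definition typeT_valid (R : numDomainType) n (t : typeT R n) : Prop :=
  [/\ lev 0 (t_a t), lev 0 (t_b t), lev 0 (t_c t) & 0 <= t_v t].

Definition typeT_set (R : numDomainType) n (N : nominal R n) :
    set ('cV[R]_n * 'cV[R]_n * 'cV[R]_n) :=
  [set s | let: (x, y1, y2) := s in
    [/\ satisfies N (x + y1) /\ satisfies N (x + y2),
        lev (x + y1) (const_mx 1) /\ lev (x + y2) (const_mx 1)
      & [/\ binary x, binary y1 & binary y2]]].

Definition typeT_cost (R : numDomainType) n (t : typeT R n)
    (s : 'cV[R]_n * 'cV[R]_n * 'cV[R]_n) : R :=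
  let: (x, y1, y2) := s in
  dot (t_a t) x + dot (t_b t) y1 + dot (t_c t) y2 + t_v t.

Definition typeT_value (R : realType) n (N : nominal R n) (t : typeT R n) :
    \bar R :=
  ereal_inf [set (typeT_cost t s)%:E | s in typeT_set N].

(** * Growth rates *)

Definition big_O (f g : nat -> nat) : Prop :=
  exists K n0 : nat, forall n : nat, (n0 <= n)%N -> (f n <= K * g n)%N.

(** * Polynomial time *)

(* The machine model is a while-language on binary trees with rational leaves.
   Every elementary operation costs the full bit size of its argument, and it
   increases the bit size at most by a constant factor and constant summand
   that depend only on the operation.  Hence total cost and the running time
   of a Turing machine are polynomially related. *)
Inductive data := Atom of rat | Pair of data & data.

Definition bits (k : nat) : nat := (trunc_log 2 k).+1.

Fixpoint dsize (x : data) : nat :=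
  match x with
  | Atom q => (bits `|numq q| + bits `|denq q|)%N.+1
  | Pair a b => (dsize a + dsize b)%N.+1
  end.

Inductive op :=
  Id | Const of data | Fst | Snd | IsAtom | Add | Opp | Mul | Inv.

(* Operations are total: an argument of the wrong shape yields Atom 0. *)
Definition op_eval (o : op) (x : data) : data :=
  match o, x with
  | Id, _ => x
  | Const d, _ => d
  | Fst, Pair a _ => a
  | Snd, Pair _ b => b
  | IsAtom, Atom _ => Atom 1
  | Add, Pair (Atom p) (Atom q) => Atom (p + q)
  | Opp, Atom q => Atom (- q)
  | Mul, Pair (Atom p) (Atom q) => Atom (p * q)
  | Inv, Atom q => Atom q^-1
  | _, _ => Atom 0
  end.

(* Tests succeed on positive numbers. *)
Definition truthy (x : data) : bool := if x is Atom q then 0 < q else false.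

Inductive prog :=
  | Op of op
  | Fork of prog & prog
  | Seq of prog & prog
  | If of prog & prog & prog
  | While of prog & prog.

(* exec p x t y: on input x, the program p halts with output y at cost t. *)
Inductive exec : prog -> data -> nat -> data -> Prop :=
  | exec_op o x : exec (Op o) x (dsize x) (op_eval o x)
  | exec_fork p q x s t y z :
      exec p x s y -> exec q x t z -> exec (Fork p q) x (s + t)%N (Pair y z)
  | exec_seq p q x s t y z :
      exec p x s y -> exec q y t z -> exec (Seq p q) x (s + t)%N z
  | exec_if_true c p q x s t b y :
      exec c x s b -> truthy b -> exec p x t y -> exec (If c p q) x (s + t)%N y
  | exec_if_false c p q x s t b y :
      exec c x s b -> ~~ truthy b -> exec q x t y ->
      exec (If c p q) x (s + t)%N y
  | exec_while_false c p x s b :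
      exec c x s b -> ~~ truthy b -> exec (While c p) x s x
  | exec_while_true c p x r s t b y z :
      exec c x r b -> truthy b -> exec p x s y -> exec (While c p) y t z ->
      exec (While c p) x (r + s + t)%N z.

(* A computational problem is a type of instances, of which only the valid ones
   have to be solved, an encoding of instances, and a specification of the
   correct answers. *)
Definition poly_time (I : Type) (valid : I -> Prop) (code : I -> data)
    (correct : I -> data -> Prop) : Prop :=
  exists (p : prog) (k : nat), forall i, valid i ->
    exists (t : nat) (y : data),
      [/\ exec p (code i) t y, (t <= k * dsize (code i) ^ k)%N & correct i y].

Definition code_vec n (v : 'cV[rat]_n) : data :=
  foldr (fun i l => Pair (Atom (v i 0)) l) (Atom 0) (enum 'I_n).

(* w is the code of the nominal problem. *)
Definition code_typeT (w : data) n (t : typeT rat n) : data :=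
  Pair w (Pair (code_vec (t_a t)) (Pair (code_vec (t_b t))
    (Pair (code_vec (t_c t)) (Atom (t_v t))))).

Definition code_robust (w : data) n (u : budgeted rat n) : data :=
  Pair w (Pair (code_vec (c_lo u)) (Pair (code_vec (c_up u))
    (Pair (code_vec (d_lo u)) (Pair (code_vec (d_up u)) (Atom (budget u)))))).

Definition real_vec (R : realType) n (v : 'cV[rat]_n) : 'cV[R]_n :=
  map_mx ratr v.

Definition real_typeT (R : realType) n (t : typeT rat n) : typeT R n :=
  TypeT (real_vec R (t_a t)) (real_vec R (t_b t)) (real_vec R (t_c t))
    (ratr (t_v t)).

Definition real_budgeted (R : realType) n (u : budgeted rat n) : budgeted R n :=
  Budgeted (real_vec R (c_lo u)) (real_vec R (c_up u))
    (real_vec R (d_lo u)) (real_vec R (d_up u)) (ratr (budget u)).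

(* To solve a problem is to report infeasibility (answer Atom 0) or to return
   the optimal value together with an optimal solution. *)
Definition typeT_answer (R : realType) n (N : nominal R n) (t : typeT rat n)
    (r : data) : Prop :=
  (typeT_set N = set0 /\ r = Atom 0) \/
  exists (q : rat) (x y1 y2 : 'cV[rat]_n),
    let s := (real_vec R x, real_vec R y1, real_vec R y2) in
    [/\ r = Pair (Atom q)
              (Pair (code_vec x) (Pair (code_vec y1) (code_vec y2))),
        typeT_set N s,
        typeT_cost (real_typeT R t) s = ratr q
      & typeT_value N (real_typeT R t) = (ratr q)%:E].

Definition robust_answer (R : realType) n (N : nominal R n)
    (u : budgeted rat n) (r : data) : Prop :=
  (robust_value N (real_budgeted R u) = +oo%E /\ r = Atom 0) \/
  exists (q : rat) (x : 'cV[rat]_n),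
    [/\ r = Pair (Atom q) (code_vec x),
        binary x,
        worst_cost N (real_budgeted R u) (real_vec R x) = (ratr q)%:E
      & robust_value N (real_budgeted R u) = (ratr q)%:E].

(* A class of nominal problems is a family N, indexed by an arbitrary type I,
   on n i items, with an arbitrary encoding.  The constraints of N i need not
   be listed explicitly by code i. *)
Definition typeT_poly_time (R : realType) (I : Type) (n : I -> nat)
    (N : forall i, nominal R (n i)) (code : I -> data) : Prop :=
  @poly_time {i : I & typeT rat (n i)}
    (fun it => typeT_valid (projT2 it))
    (fun it => code_typeT (code (projT1 it)) (projT2 it))
    (fun it r => typeT_answer (N (projT1 it)) (projT2 it) r).

Definition robust_poly_time (R : realType) (I : Type) (n : I -> nat)
    (N : forall i, nominal R (n i)) (code : I -> data) : Prop :=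
  @poly_time {i : I & budgeted rat (n i)}
    (fun iu => budgeted_valid (projT2 iu))
    (fun iu => code_robust (code (projT1 iu)) (projT2 iu))
    (fun iu r => robust_answer (N (projT1 iu)) (projT2 iu) r).

(* Main.v *)
Require Import Defs.
From HB Require Import structures.
From mathcomp Require Import all_boot all_order all_algebra.
From mathcomp Require Import all_classical all_reals ereal.
From mathcomp Require Import ring lra zify.

Set Implicit Arguments.
Unset Strict Implicit.
Unset Printing Implicit Defensive.
Import Order.TTheory GRing.Theory Num.Theory.

Local Open Scope classical_set_scope.
Local Open Scope ring_scope.

(** Fix a binary first-stage decision [x].  For a binary decision, the worst
case of one stage under a budget [B] is a fractional knapsack problem.  Its
linear programming dual has a single variable, the price [p] of the budget:
the worst case equals the minimum of [dot (price lo up p) y + B * p] over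
[p >= 0], where item [i] costs [lo i + max(up i - lo i - p, 0)].  The minimum
is attained at [0] or at some [up i - lo i]
([uncertainty_le_price], [price_attained]).  The finite list [thresholds]
contains these breakpoints for both stages.

If the adversary spends [r] of the budget [G] in the first stage, the worst
case of [x] is therefore the maximum over [0 <= r <= G] of
[min_s (k s + r * s) + min_p (h p + (G - r) * p)], where [k] and [h] are the
costs of the two stages at given prices, [h] with the best second-stage
decision for the price.  Minimax exchanges the maximum over [r] with the
minimum over [s] and over probability distributions of [p].  On a line two
prices [p <= s < q] suffice, and their weights are fixed by the condition that
their mean is [s].  Hence the worst case of [x] is the minimum, over triples
of thresholds, of
[G * s + k s + w * h p + (1 - w) * h q] ([saddle]).  Once [x] is minimized as
well, every triple is a problem of type (T), whose two second-stage decisions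
are the minimizers for [p] and [q] ([candidate]).  There are at most
[2 * n + 1] thresholds, hence [O(n ^ 3)] triples.  When [s] is itself the
price used in the second stage, the weight is one and the second scenario is
free, so that only one second-stage decision is paid for; these are problems
of nominal type, and they are kept among the problems of type (T).  The list
of nominal problems can then be empty.

For the running time, the data of each problem of type (T) arise from the
instance by a bounded number of rational operations per entry, so that their
size is polynomial.  The program runs through the triples, calls the solver for
type (T) and keeps an answer of least value.  The first-stage decision of that
answer is optimal, because the cost of every feasible solution of such a
problem bounds the worst case of its first-stage decision from above
([worst_cost_le_candidate]).  Polynomial time is derived compositionally:
[ptime] relates an input and an output that depend on the same index, and
every program construct preserves it because the size of an output is bounded
linearly by the cost of the execution ([exec_output]). *)

(** * A weighted minimax principle on a line *)

Section Excess.
Variable F : realFieldType.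
Implicit Types w t s p q z : F.

Definition excess w t : F := Num.max (w - t) 0.

Lemma excess_ge0 w t : 0 <= excess w t.
Proof. by rewrite le_max lexx orbT. Qed.

Lemma excess_geB w t : w - t <= excess w t.
Proof. by rewrite le_max lexx. Qed.

Lemma excess_eq w t : t <= w -> excess w t = w - t.
Proof. by move=> h; rewrite /excess max_l // subr_ge0. Qed.

Lemma excess_eq0 w t : w <= t -> excess w t = 0.
Proof. by move=> h; rewrite /excess max_r // subr_le0. Qed.

Lemma excess_le w t c : 0 <= c -> w - t <= c -> excess w t <= c.
Proof. by move=> c0 wc; rewrite ge_max wc c0. Qed.

Lemma excess_decr w s t : s <= t -> excess w t <= excess w s.
Proof.
move=> st; apply: excess_le; first exact: excess_ge0.
by have := excess_geB w s; lra.
Qed.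

Lemma excess_convex w p s q : p <= s -> s <= q ->
  (q - p) * excess w s <= (q - s) * excess w p + (s - p) * excess w q.
Proof.
move=> ps sq; have [sq0 ps0] : 0 <= q - s /\ 0 <= s - p by rewrite !subr_ge0.
have [sw|ws] := leP s w; last first.
  by rewrite (excess_eq0 (ltW ws)) mulr0 addr_ge0 ?mulr_ge0 ?excess_ge0.
rewrite (excess_eq sw).
have := lerD (ler_wpM2l sq0 (excess_geB w p)) (ler_wpM2l ps0 (excess_geB w q)).
by apply: le_trans; rewrite le_eqVlt; apply/orP; left; apply/eqP; ring.
Qed.

End Excess.

Section Saddle.
Variable F : realFieldType.

(** The distribution on two prices [p] and [q] with mean [s]: [split_weight] is
the mass of the lower one.  Where [p <= s < q] fails, all mass sits at [s],
so that [split_mean] holds for every triple. *)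
Definition split_weight (p s q : F) : F :=
  if (p <= s) && (s < q) then (q - s) / (q - p) else 1.

Definition split_low (p s q : F) : F := if (p <= s) && (s < q) then p else s.

Lemma split_weight_itv p s q : 0 <= split_weight p s q <= 1.
Proof.
rewrite /split_weight; case: ifP => [/andP[ps sq]|_]; last by rewrite ler01 lexx.
have qp : 0 < q - p by rewrite subr_gt0; apply: le_lt_trans sq.
rewrite divr_ge0 ?ler_pdivrMr ?mul1r //=; lra.
Qed.

Lemma split_mean p s q :
  split_weight p s q * split_low p s q + (1 - split_weight p s q) * q = s.
Proof.
rewrite /split_weight /split_low; case: ifP => [/andP[ps sq]|_]; last by ring.
by field; rewrite gt_eqF // subr_gt0; apply: le_lt_trans sq.
Qed.

Lemma split_low_ge0 p s q : 0 <= p -> 0 <= s -> 0 <= split_low p s q.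
Proof. by rewrite /split_low; case: ifP. Qed.

Variables (Q : seq F) (k h : F -> F) (G V : F).
Hypothesis G_ge0 : 0 <= G.
Hypothesis k_decr : forall s t, s <= t -> k t <= k s.
Hypothesis h_decr : forall s t, s <= t -> h t <= h s.
Hypothesis k_convex : forall p s q, p <= s -> s <= q ->
  (q - p) * k s <= (q - s) * k p + (s - p) * k q.
Hypothesis V_le : {in Q & &, forall s p q,
  V <= G * s + k s
       + (split_weight p s q * h (split_low p s q) + (1 - split_weight p s q) * h q)}.

Lemma saddle_single s : s \in Q -> V <= G * s + k s + h s.
Proof.
move=> sQ; have := V_le sQ sQ sQ.
by rewrite /split_weight /split_low ltxx andbF; lra.
Qed.

(** The hypothesis on [V] with the denominator cleared, which makes [s = q]
admissible. *)
Lemma saddle_split s p q : s \in Q -> p \in Q -> q \in Q -> p <= s -> s <= q ->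
  (q - p) * V <= (q - p) * (G * s + k s) + (q - s) * h p + (s - p) * h q.
Proof.
move=> sQ pQ qQ ps; rewrite le_eqVlt => /orP[/eqP <-|sq].
  by have := saddle_single sQ; nra.
have := V_le sQ pQ qQ; rewrite /split_weight /split_low ps sq /=.
have qp : 0 < q - p by rewrite subr_gt0; apply: le_lt_trans sq.
rewrite -(ler_pM2l qp) => /le_trans; apply; rewrite le_eqVlt; apply/orP; left.
by apply/eqP; field; rewrite gt_eqF.
Qed.

(** Replace [k] and [h] by their chords over two intervals that both contain
[z].  The total is affine on the intersection of the intervals, so it is at
least its smaller value at the two endpoints of the intersection.  Each of these
endpoints comes from one interval and lies in the other.  If it is one of the
[s], the hypothesis on [V] applies to it and to the interval of the [p]; if it
is one of the [p], the chord of [k] lies above [k] by convexity. *)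
Lemma saddle_chords s1 s2 p1 p2 z a b c d :
  s1 \in Q -> s2 \in Q -> p1 \in Q -> p2 \in Q ->
  s1 <= z <= s2 -> p1 <= z <= p2 ->
  k s1 = a + b * s1 -> k s2 = a + b * s2 ->
  h p1 = c + d * p1 -> h p2 = c + d * p2 ->
  V <= G * z + (a + b * z) + (c + d * z).
Proof.
move=> s1Q s2Q p1Q p2Q /andP[s1z zs2] /andP[p1z zp2] ks1 ks2 hp1 hp2.
have at_s s : s \in Q -> k s = a + b * s -> p1 <= s -> s <= p2 ->
    V <= G * s + (a + b * s) + (c + d * s).
  move=> sQ ks p1s sp2; have [e|p12] := eqVneq p1 p2.
    have es : s = p1 by lra.
    by have := saddle_single p1Q; rewrite -{1 2}es ks es hp1.
  have gap : 0 < p2 - p1 by rewrite subr_gt0 lt_neqAle p12; lra.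
  rewrite -(ler_pM2l gap); have := saddle_split sQ p1Q p2Q p1s sp2.
  rewrite ks hp1 hp2; lra.
have at_p p : p \in Q -> h p = c + d * p -> s1 <= p -> p <= s2 ->
    V <= G * p + (a + b * p) + (c + d * p).
  move=> pQ hp s1p ps2; apply: le_trans (saddle_single pQ) _.
  rewrite hp lerD2r lerD2l; have [e|s12] := eqVneq s1 s2.
    by have es : p = s1; [lra | rewrite es ks1].
  have gap : 0 < s2 - s1 by rewrite subr_gt0 lt_neqAle s12; lra.
  rewrite -(ler_pM2l gap); apply: le_trans (k_convex s1p ps2) _.
  by rewrite ks1 ks2; lra.
have [e1 [e1z Ve1]] : exists e, e <= z /\ V <= G * e + (a + b * e) + (c + d * e).
  have [sp|ps] := leP s1 p1.
    by exists p1; split=> //; apply: at_p => //; lra.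
  by exists s1; split=> //; apply: at_s => //; lra.
have [e2 [ze2 Ve2]] : exists e, z <= e /\ V <= G * e + (a + b * e) + (c + d * e).
  have [sp|ps] := leP s2 p2.
    by exists s2; split=> //; apply: at_s => //; lra.
  by exists p2; split=> //; apply: at_p => //; lra.
have [slope|slope] := leP 0 (G + b + d).
  by apply: le_trans Ve1 _; nra.
by apply: le_trans Ve2 _; nra.
Qed.

Lemma chord (f : F -> F) u v : exists a b, f u = a + b * u /\ f v = a + b * v.
Proof.
have [<-|uv] := eqVneq u v; first by exists (f u), 0; split; ring.
have d : v - u != 0 by rewrite subr_eq0 eq_sym.
by exists (f u - (f v - f u) / (v - u) * u), ((f v - f u) / (v - u)); split; field.
Qed.

(** A pair with [p1 < s1] bounds the saddle point from below and a pair with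
[s2 < p2] bounds it from above.  The weights that cancel the two slopes give
the [s] and the [p] the same mean [z], and [saddle_chords] applies at [z]. *)
Lemma saddle_cross s1 p1 s2 p2 :
  s1 \in Q -> s2 \in Q -> p1 \in Q -> p2 \in Q -> p1 < s1 -> s2 < p2 ->
  (V - (G * p1 + k s1 + h p1)) / (s1 - p1)
    <= (G * p2 + k s2 + h p2 - V) / (p2 - s2).
Proof.
move=> s1Q s2Q p1Q p2Q lt1 lt2.
have [x_gt0 y_gt0] : 0 < s1 - p1 /\ 0 < p2 - s2 by rewrite !subr_gt0.
set x := s1 - p1 in x_gt0 *; set y := p2 - s2 in y_gt0 *.
rewrite ler_pdivrMr // mulrAC ler_pdivlMr //.
have xy : 0 < x + y by exact: addr_gt0.
pose z := (y * s1 + x * s2) / (x + y).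
have zs : (x + y) * z = y * s1 + x * s2 by rewrite /z; field; rewrite gt_eqF.
have zp : (x + y) * z = y * p1 + x * p2 by rewrite zs /x /y; ring.
have [a [b [ks1 ks2]]] := chord k s1 s2.
have [c [d [hp1 hp2]]] := chord h p1 p2.
suff Vz : V <= G * z + (a + b * z) + (c + d * z).
  have := ler_wpM2l (ltW xy) Vz; rewrite ks1 ks2 hp1 hp2.
  have -> : (x + y) * (G * z + (a + b * z) + (c + d * z)) =
    G * ((x + y) * z) + b * ((x + y) * z) + d * ((x + y) * z) + (x + y) * (a + c).
    by ring.
  by rewrite {1 3}zp zs; lra.
have sorted (f : F -> F) u v e l : u \in Q -> v \in Q ->
    (x + y) * z = y * u + x * v -> f u = e + l * u -> f v = e + l * v ->
    exists u' v', [/\ u' \in Q, v' \in Q, u' <= z <= v',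
      f u' = e + l * u' & f v' = e + l * v'].
  move=> uQ vQ ez fu fv.
  have xi w : u <= w -> v <= w -> z <= w.
    by move=> uw vw; rewrite -(ler_pM2l xy) ez; nra.
  have xs w : w <= u -> w <= v -> w <= z.
    by move=> uw vw; rewrite -(ler_pM2l xy) ez; nra.
  have [uv|/ltW vu] := leP u v.
    by exists u, v; split; rewrite // xi ?xs.
  by exists v, u; split; rewrite // xi ?xs.
have [s [s' [sQ s'Q sz ks ks']]] := sorted k _ _ _ _ s1Q s2Q zs ks1 ks2.
have [p [p' [pQ p'Q pz hp hp']]] := sorted h _ _ _ _ p1Q p2Q zp hp1 hp2.
exact: saddle_chords sQ s'Q pQ p'Q sz pz ks ks' hp hp'.
Qed.

(** Each pair [(t, p)] restricts [s] by one linear inequality.  These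
half-lines, together with [0 <= s <= G], have a common point because any two
of them meet, which is Helly's theorem on the line.  The largest lower bound is
such a point. *)
Lemma saddle : exists2 s, 0 <= s <= G &
  {in Q &, forall t p, V <= k t + s * t + (h p + (G - s) * p)}.
Proof.
pose L := [seq (V - (G * u.2 + k u.1 + h u.2)) / (u.1 - u.2)
  | u <- [seq (t, p) | t <- Q, p <- Q] & u.2 < u.1].
pose s := \big[Num.max/0]_(l <- L) l.
have inL t p : t \in Q -> p \in Q -> p < t ->
    (V - (G * p + k t + h p)) / (t - p) <= s.
  move=> tQ pQ pt; apply: (le_bigmax_seq 0 _ xpredT id) => //.
  apply/mapP; exists (t, p) => //=; rewrite mem_filter /= pt.
  by apply/allpairsP; exists (t, p).
have s_le m : 0 <= m -> (forall t p, t \in Q -> p \in Q -> p < t ->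
    (V - (G * p + k t + h p)) / (t - p) <= m) -> s <= m.
  move=> m0 Lm; rewrite /s big_seq; apply: bigmax_le => // l /mapP[[t p]] /=.
  rewrite mem_filter /= => /andP[pt /allpairsP[[t' p'] /= [tQ pQ e]]] ->.
  by move: pt; case: e => -> -> pt; apply: Lm.
exists s.
  rewrite bigmax_ge_id /=; apply: s_le => // t p tQ pQ pt.
  rewrite ler_pdivrMr ?subr_gt0 //.
  by have := saddle_single tQ; have := h_decr (ltW pt); lra.
move=> t p tQ pQ; have [tp|pt|<-] := ltgtP t p.
- have : s <= (G * p + k t + h p - V) / (p - t).
    apply: s_le => [|t' p' t'Q p'Q pt]; last exact: saddle_cross.
    rewrite divr_ge0 ?subr_ge0 ?(ltW tp) //.
    by have := saddle_single pQ; have := k_decr (ltW tp); lra.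
  by rewrite ler_pdivlMr ?subr_gt0 //; lra.
- by have := inL _ _ tQ pQ pt; rewrite ler_pdivrMr ?subr_gt0 //; lra.
- by have := saddle_single tQ; lra.
Qed.

End Saddle.

(** * Dualizing one stage of the budgeted uncertainty *)

Section Price.
Variables (F : realFieldType) (n : nat).
Implicit Types (lo up d y : 'cV[F]_n) (p B : F).

(** The item costs of the dual: the adversary raises the cost of an item by its
whole range, but pays [p] for it out of the budget. *)
Definition price lo up p : 'cV[F]_n :=
  \col_i (lo i 0 + excess (up i 0 - lo i 0) p).

Lemma dot_price lo up p y :
  dot (price lo up p) y =
  dot lo y + \sum_i excess (up i 0 - lo i 0) p * y i 0.
Proof.
by rewrite /dot -big_split; apply: eq_bigr => i _ /=; rewrite mxE mulrDl.
Qed.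

Lemma binary_itv y i : binary y -> 0 <= y i 0 <= 1.
Proof. by move/(_ i) => [->|->]; rewrite lexx ler01. Qed.

Lemma price_ge0 lo up p i : 0 <= lo i 0 -> 0 <= price lo up p i 0.
Proof. by move=> l0; rewrite mxE addr_ge0 ?excess_ge0. Qed.

Lemma dot_price_decr lo up y s t : binary y -> s <= t ->
  dot (price lo up t) y <= dot (price lo up s) y.
Proof.
move=> by_ st; apply: ler_sum => i _; rewrite !mxE ler_wpM2r ?lerD2l ?excess_decr //.
by case/andP: (binary_itv i by_).
Qed.

Lemma dot_price_convex lo up y p s q : binary y -> p <= s -> s <= q ->
  (q - p) * dot (price lo up s) y
    <= (q - s) * dot (price lo up p) y + (s - p) * dot (price lo up q) y.
Proof.
move=> by_ ps sq; rewrite /dot !mulr_sumr -big_split /=; apply: ler_sum => i _.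
have [y0 _] := andP (binary_itv i by_); rewrite !mxE !mulrA -mulrDl.
rewrite ler_wpM2r //; have := excess_convex (up i 0 - lo i 0) ps sq; lra.
Qed.

(** Weak duality: for each item of [y], raising by [g * delta] gains at most
[max(g - p, 0) + p * delta]. *)
Lemma uncertainty_le_price lo up d y p B :
  uncertainty lo up B d -> binary y -> 0 <= p ->
  dot d y <= dot (price lo up p) y + B * p.
Proof.
move=> [_ [delta [dE delta01 sumB]]] by_ p0.
apply: (@le_trans _ _ (dot (price lo up p) y + (\sum_i delta i) * p)); last first.
  by rewrite lerD2l ler_wpM2r.
rewrite mulr_suml -big_split; apply: ler_sum => i _ /=; rewrite mxE dE.
have := excess_geB (up i 0 - lo i 0) p; have := excess_ge0 (up i 0 - lo i 0) p.
by have /andP[? ?] := delta01 i; case: (by_ i) => ->; nra.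
Qed.

(** Strong duality for the fractional knapsack, by the greedy solution.  If the
budget is below one, all of it goes to a heaviest item and its weight is the
optimal price.  Otherwise that item is taken entirely and the induction
continues with the remaining items and budget; the price found there is at most
the removed weight, so that the removed item contributes its full excess. *)
Lemma knapsack (I : finType) (w : I -> F) (A : {set I}) B :
  (forall i, 0 <= w i) -> 0 <= B ->
  exists delta p, [/\ forall i, 0 <= delta i <= 1, \sum_i delta i <= B,
    p = 0 \/ (exists2 i, i \in A & p = w i),
    forall i, i \notin A -> delta i = 0
    & B * p + \sum_(i in A) excess (w i) p <= \sum_(i in A) w i * delta i].
Proof.
move=> w0; have [m] := ubnP #|A|; elim: m A B => // m IH A B Am B0.
have [->|[i0 i0A]] := set_0Vmem A.
  exists (fun=> 0), 0; split=> //; first by move=> i; rewrite lexx ler01.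
  - by rewrite big1.
  - by left.
  - by rewrite !big_set0 mulr0 addr0.
pose i := [arg max_(i > i0 in A) w i]%O.
have [iA imax] : i \in A /\ {in A, forall j, w j <= w i}.
  by rewrite /i; case: arg_maxP => // j jA jmax; split=> // l /jmax.
have [B1|B1] := ltP B 1.
  exists (fun j => if j == i then B else 0), (w i); split.
  - by move=> j; case: eqP => _; rewrite ?B0 ?(ltW B1) // lexx ler01.
  - by rewrite (bigD1 i) //= eqxx big1 ?addr0 // => j; case: eqP.
  - by right; exists i.
  - by move=> j jA; case: eqP => // ji; rewrite ji iA in jA.
  - rewrite [X in _ + X]big1 => [|j jA]; last by rewrite excess_eq0 ?imax.
    rewrite (bigD1 i) //= eqxx big1 ?addr0; first by rewrite mulrC.
    by move=> j /andP[_ /negPf->]; rewrite mulr0.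
have [||delta [p [d01 dB pE dA opt]]] := IH (A :\ i)%SET (B - 1).
- by move: Am; rewrite (cardsD1 i A) iA add1n !ltnS; apply.
- by rewrite subr_ge0.
have di : delta i = 0 by apply: dA; rewrite !inE eqxx.
exists (fun j => if j == i then 1 else delta j), p; split.
- by move=> j; case: eqP => _; rewrite // ler01 lexx.
- rewrite (bigD1 i) //= eqxx.
  have -> : \sum_(j | j != i) (if j == i then 1 else delta j) = \sum_j delta j.
    rewrite [RHS](bigD1 i) //= di add0r.
    by apply: eq_bigr => j /negPf->.
  by rewrite -lerBrDl.
- case: pE => [->|[j]]; first by left.
  by rewrite inE => /andP[_ jA] ->; right; exists j.
- move=> j jA; case: eqP => [ji|_]; first by rewrite ji iA in jA.
  by apply: dA; rewrite inE negb_and jA orbT.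
- have pw : p <= w i by case: pE => [->//|[j]]; rewrite inE => /andP[_ /imax + ->].
  have -> : \sum_(j in A) w j * (if j == i then 1 else delta j) =
      w i + \sum_(j in A :\ i) w j * delta j.
    rewrite (big_setD1 i) //= eqxx mulr1; congr (_ + _).
    by apply: eq_bigr => j /setD1P[/negPf-> _].
  by rewrite (big_setD1 i) //= excess_eq //; lra.
Qed.

Lemma price_attained lo up y B :
  (forall i, 0 <= lo i 0 <= up i 0) -> binary y -> 0 <= B ->
  exists d p, [/\ uncertainty lo up B d,
    p = 0 \/ (exists i, p = up i 0 - lo i 0)
    & dot (price lo up p) y + B * p <= dot d y].
Proof.
move=> lu by_ B0.
have gap i : 0 <= up i 0 - lo i 0 by rewrite subr_ge0; case/andP: (lu i).
pose A := [set i | y i 0 == 1]%SET.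
have [delta [p [d01 dB pE dA opt]]] :=
  knapsack A (w := fun i => up i 0 - lo i 0) gap B0.
exists (\col_i (lo i 0 + (up i 0 - lo i 0) * delta i)), p; split.
- split=> [i|]; last by exists delta; split=> // i; rewrite mxE.
  rewrite mxE addr_ge0 ?mulr_ge0 //; first by case/andP: (lu i).
  by case/andP: (d01 i).
- by case: pE => [|[i _]]; [left|right; exists i].
have onA (f : 'I_n -> F) : \sum_i f i * y i 0 = \sum_(i in A) f i.
  rewrite [RHS]big_mkcond; apply: eq_bigr => i _; rewrite inE.
  by case: (by_ i) => ->; rewrite ?eqxx ?mulr1 // eq_sym oner_eq0 mulr0.
rewrite dot_price onA; have := opt; rewrite /dot.
under [in X in _ -> _ <= X]eq_bigr => i _ do rewrite mxE mulrDl.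
by rewrite big_split /= !onA; lra.
Qed.

End Price.

(** * Reducing the robust problem to problems of type (T) *)

Section Candidates.
Variables (F : realFieldType) (n : nat) (u : budgeted F n).

Definition gap (lo up : 'cV[F]_n) i : F := up i 0 - lo i 0.

Definition thresholds : seq F :=
  0 :: [seq gap (c_lo u) (c_up u) i | i <- enum 'I_n]
    ++ [seq gap (d_lo u) (d_up u) i | i <- enum 'I_n].

(** The first-stage price is [s]; in the second stage the prices
[split_low p s q] and [q] are mixed with mean [s]. *)
Definition candidate (s p q : F) : typeT F n :=
  let w := split_weight p s q in
  TypeT (price (c_lo u) (c_up u) s)
        (w *: price (d_lo u) (d_up u) (split_low p s q))
        ((1 - w) *: price (d_lo u) (d_up u) q)
        (budget u * s).

Definition triples : seq (F * (F * F)) :=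
  [seq (s, pq) | s <- thresholds,
    pq <- [seq (p, q) | p <- thresholds, q <- thresholds]].

Lemma size_triples : size triples = (n.*2.+1 ^ 3)%N.
Proof.
have szQ : size thresholds = n.*2.+1.
  by rewrite /= size_cat !size_map -enumT size_enum_ord addnn.
by rewrite !size_allpairs szQ !expnS expn0 muln1.
Qed.

Lemma triplesP s p q : reflect
  [/\ s \in thresholds, p \in thresholds & q \in thresholds] ((s, (p, q)) \in triples).
Proof.
apply: (iffP allpairsP) => [[[s' pq] [sQ pqQ [-> e]]]|[sQ pQ qQ]].
  move: pqQ; rewrite [(_, _).2](esym e) => /allpairsP[[p' q'] [pQ qQ [-> ->]]].
  by split.
by exists (s, (p, q)); split=> //; apply: (allpairs_f pair).
Qed.

Hypothesis uV : budgeted_valid u.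

Lemma thresholds_ge0 : {in thresholds, forall s, 0 <= s}.
Proof.
case: uV => clu dlu _ s; rewrite inE mem_cat => /or3P[/eqP->//| |] /mapP[i _ ->].
  by rewrite subr_ge0; case/andP: (clu i).
by rewrite subr_ge0; case/andP: (dlu i).
Qed.

Lemma candidate_valid s p q : 0 <= s -> typeT_valid (candidate s p q).
Proof.
case: uV => clu dlu G0 s0; have /andP[w0 w1] := split_weight_itv p s q.
have lo0 (lo up : 'cV[F]_n) t i : (forall i, 0 <= lo i 0 <= up i 0) ->
    0 <= price lo up t i 0.
  by move=> /(_ i)/andP[? _]; exact: price_ge0.
split=> [i|i|i|]; rewrite ?mulr_ge0 // mxE ?lo0 //.
  by rewrite mxE mulr_ge0 // -?mxE ?lo0.
by rewrite mxE mulr_ge0 ?subr_ge0 ?lo0.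
Qed.

End Candidates.

Section Argmin.
Variable R : realDomainType.

Lemma seq_argmin (T : eqType) (f : T -> R) (r : seq T) x :
  x \in r -> exists2 y, y \in r & {in r, forall z, f y <= f z}.
Proof.
elim: r x => // a r IH x _; case: r IH => [|b r] IH.
  by exists a; rewrite ?mem_seq1 // => z; rewrite mem_seq1 => /eqP->.
have [y yr ymin] := IH b (mem_head _ _).
have [le_ay|/ltW le_ya] := leP (f a) (f y).
  exists a; rewrite ?mem_head // => z; rewrite inE => /predU1P[->//|zr].
  exact: le_trans le_ay (ymin z zr).
exists y; first by rewrite in_cons yr orbT.
by move=> z; rewrite in_cons => /predU1P[->//|]; apply: ymin.
Qed.

Lemma binary_argmin n (f : 'cV[R]_n -> R) (S : set 'cV[R]_n) :
  S `<=` @binary R n -> S !=set0 -> exists2 y, S y & forall z, S z -> f y <= f z.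
Proof.
move=> Sbin [y0 Sy0].
pose r := [seq y <- [seq \col_i (g i : bool)%:R | g : {ffun 'I_n -> bool}] | `[< S y >]].
have inr y : S y -> y \in r.
  move=> Sy; rewrite mem_filter; apply/andP; split; first exact/asboolP.
  apply/mapP; exists [ffun i => y i 0 == 1]; first by rewrite mem_enum.
  apply/colP => i; rewrite mxE ffunE.
  by case: (Sbin _ Sy i) => ->; rewrite ?eqxx // eq_sym oner_eq0.
have [y] := seq_argmin f (inr _ Sy0).
rewrite mem_filter => /andP[/asboolP Sy _] ymin; exists y => // z /inr.
exact: ymin.
Qed.

End Argmin.

Section WorstCase.
Variables (R : realType) (n : nat) (u : budgeted R n) (N : nominal R n).
Hypothesis uV : budgeted_valid u.

Let C := price (c_lo u) (c_up u).
Let D := price (d_lo u) (d_up u).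

Definition used (c : 'cV[R]_n) : R :=
  \sum_i (c i 0 - c_lo u i 0) / (c_up u i 0 - c_lo u i 0).

Lemma candidate_cost s p q x y1 y2 :
  typeT_cost (candidate u s p q) (x, y1, y2) =
  dot (C s) x + budget u * s
  + (split_weight p s q * dot (D (split_low p s q)) y1
     + (1 - split_weight p s q) * dot (D q) y2).
Proof.
rewrite /typeT_cost /= -/(C s) -/(D q) -/(D (split_low p s q)).
have dotZ a (v y : 'cV[R]_n) : dot (a *: v) y = a * dot v y.
  by rewrite /dot mulr_sumr; apply: eq_bigr => i _; rewrite mxE mulrA.
by rewrite !dotZ; ring.
Qed.

(** Coordinates of range zero can be raised without changing [c], but the
quotients defining [used] ignore them; the budget seen by the second stage is
thus the least one that produces [c]. *)
Lemma uncertainty_used B c :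
  uncertainty (c_lo u) (c_up u) B c ->
  used c <= B /\ uncertainty (c_lo u) (c_up u) (used c) c.
Proof.
move=> [c0 [delta [cE d01 dB]]].
pose f i := (c i 0 - c_lo u i 0) / (c_up u i 0 - c_lo u i 0).
have fE i : f i = if c_up u i 0 - c_lo u i 0 == 0 then 0 else delta i.
  rewrite /f cE addrC addKr; case: eqP => [->|/eqP g0]; first by rewrite !mul0r.
  by rewrite mulrAC mulfV // mul1r.
split.
  apply: le_trans dB; apply: ler_sum => i _; rewrite -/(f i) fE.
  by case: ifP => // _; case/andP: (d01 i).
split=> //; exists f; split=> // i; rewrite fE; case: eqP => [g0|//].
- by rewrite mulr0 cE g0 mul0r.
- by rewrite lexx ler01.
Qed.

(** After [c] is revealed, the cheaper of [y1] and [y2] costs at most their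
weighted mean.  By weak duality at both stages that mean is bounded by the
dual costs plus [used c * s] and [(budget u - used c) * s], since the mean of
the second-stage prices is [s]; the terms with [used c] cancel. *)
Lemma worst_cost_le_candidate s p q x y1 y2 :
  0 <= s -> 0 <= p -> 0 <= q -> typeT_set N (x, y1, y2) ->
  (worst_cost N u x <= (typeT_cost (candidate u s p q) (x, y1, y2))%:E)%E.
Proof.
move=> s0 p0 q0 [[Ny1 Ny2] [l1 l2] [bx b1 b2]].
apply: ge_ereal_sup => _ [c cU <-]; have [usedG cused] := uncertainty_used cU.
have first := uncertainty_le_price cused bx s0.
have le_with y r : second_stage N x y -> binary y -> 0 <= r ->
    (ereal_inf [set ereal_sup [set (dot c x + dot d y)%:E | d in second_uncertainty u c]
       | y in second_stage N x] <=
     (dot c x + (dot (D r) y + (budget u - used c) * r))%:E)%E.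
  move=> yx by_ r0; apply: ge_ereal_inf; eexists; first by exists y.
  apply: ge_ereal_sup => _ [d dU <-]; rewrite lee_fin lerD2l.
  exact: uncertainty_le_price dU by_ r0.
have low0 := split_low_ge0 q p0 s0.
have := le_with y1 _ (And3 b1 Ny1 l1) b1 low0.
have := le_with y2 q (And3 b2 Ny2 l2) b2 q0.
rewrite candidate_cost.
have := split_mean p s q; have /andP[w0 w1] := split_weight_itv p s q.
set w := split_weight p s q in w0 w1 *; set l := split_low p s q.
set v1 := dot (D l) y1; set v2 := dot (D q) y2 => mean le2 le1.
rewrite -/(C s) in first.
apply: (@le_trans _ _ (dot c x + (w * v1 + (1 - w) * v2 + (budget u - used c) * s))%:E);
  last first.
  by rewrite lee_fin; lra.
have [le12|le21] := leP (v1 + (budget u - used c) * l) (v2 + (budget u - used c) * q).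
- apply: le_trans le1 _; rewrite lee_fin -mean; nra.
- apply: le_trans le2 _; rewrite lee_fin -mean; nra.
Qed.

(** Take a cheapest triple and apply [saddle] to its cost [V].  The resulting [r]
is an optimal split of the budget for the adversary: spending [r] in the first
stage and the rest in the second, by strong duality at both stages, costs at
least [V] against every second-stage decision. *)
Lemma candidate_le_worst_cost x : binary x -> second_stage N x !=set0 ->
  exists s p q y1 y2, [/\ (s, (p, q)) \in triples u, typeT_set N (x, y1, y2) &
    ((typeT_cost (candidate u s p q) (x, y1, y2))%:E <= worst_cost N u x)%E].
Proof.
move=> bx xfeas; case: (uV); set G := budget u => clu dlu G0.
have [y_ /all_and2[yx ymin]] : {y_ : R -> 'cV[R]_n & forall p, second_stage N x (y_ p) /\
    forall z, second_stage N x z -> dot (D p) (y_ p) <= dot (D p) z}.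
  apply: (choice (P := fun p y => second_stage N x y /\
    forall z, second_stage N x z -> dot (D p) y <= dot (D p) z)) => p.
  have [|y] := @binary_argmin _ n (dot (D p)) _ _ xfeas; first by move=> y [].
  by exists y.
(* y_ p is an optimal second-stage decision at price p, and h its cost. *)
pose k s := dot (C s) x; pose h p := dot (D p) (y_ p).
have k_decr s t : s <= t -> k t <= k s by exact: dot_price_decr.
have h_decr s t : s <= t -> h t <= h s.
  move=> st; apply: le_trans (ymin t _ (yx s)) _.
  by apply: dot_price_decr st; case: (yx s).
pose cost (s p q : R) := G * s + k s
  + (split_weight p s q * h (split_low p s q) + (1 - split_weight p s q) * h q).
have Q0 : 0 \in thresholds u by exact: mem_head.
have [[s [p q]] spq /= least] := seq_argmin (fun t => cost t.1 t.2.1 t.2.2)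
  (introT (triplesP u 0 0 0) (And3 Q0 Q0 Q0)).
exists s, p, q, (y_ (split_low p s q)), (y_ q); split=> //.
  by have [? ? ?] := yx (split_low p s q); have [? ? ?] := yx q.
have [r /andP[r0 rG] value_le] : exists2 r, 0 <= r <= G &
    {in thresholds u &, forall t p', cost s p q <= k t + r * t + (h p' + (G - r) * p')}.
  apply: saddle => // [p' s' q'|s' p' q' s'Q p'Q q'Q]; first exact: dot_price_convex.
  by apply: (least (_, (_, _))); apply/triplesP.
have costE : typeT_cost (candidate u s p q) (x, y_ (split_low p s q), y_ q) = cost s p q.
  by rewrite candidate_cost /cost /k /h /G; ring.
apply: (@le_trans _ _ (cost s p q)%:E); first by rewrite -costE.
have [c [t [cU tE c_ge]]] := price_attained clu bx r0.
have [used_le _] := uncertainty_used cU.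
have cG : first_uncertainty u c.
  by case: cU => c0 [delta [? ? dr]]; split=> //; exists delta; split=> //; exact: le_trans rG.
apply: le_trans (ereal_sup_ubound _); last by exists c.
apply: le_ereal_inf_tmp => _ [y yxs <-].
have [by_ _ _] := yxs.
have Gr0 : 0 <= G - r by rewrite subr_ge0.
have [d [p' [[d0 [delta [dE d01 dG]]] p'E d_ge]]] := price_attained dlu by_ Gr0.
apply: le_trans (ereal_sup_ubound _); last first.
  exists d => //; split=> //; exists delta; split=> //; apply: le_trans dG _.
  by rewrite lerD2l lerN2.
have tQ : t \in thresholds u.
  rewrite inE mem_cat; case: tE => [->|[i ->]]; first by rewrite eqxx.
  by rewrite (map_f (gap _ _)) ?orbT // mem_enum.
have p'Q : p' \in thresholds u.
  rewrite inE mem_cat; case: p'E => [->|[i ->]]; first by rewrite eqxx.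
  by rewrite (map_f (gap (d_lo u) (d_up u))) ?orbT // mem_enum.
rewrite lee_fin; have := value_le _ _ tQ p'Q; have := ymin p' _ yxs.
by move: c_ge d_ge; rewrite -/(C t) -/(D p') -/(k t) -/(h p'); lra.
Qed.

End WorstCase.

Section RobustValue.
Variables (R : realType) (n : nat) (u : budgeted R n) (N : nominal R n).
Hypothesis uV : budgeted_valid u.

(** A first-stage decision without feasible completion has infinite worst
case, as the uncertainty set contains the lower bounds. *)
Lemma robust_value_ge v :
  (forall s p q, (s, (p, q)) \in triples u -> (v <= typeT_value N (candidate u s p q))%E) ->
  (v <= robust_value N u)%E.
Proof.
move=> v_le; apply: le_ereal_inf_tmp => _ [x bx <-].
have [empty|/set0P feas] := eqVneq (second_stage N x) set0.
  have -> : worst_cost N u x = +oo%E; last exact: leey.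
  apply/eqP; rewrite -leye_eq; apply: le_trans (ereal_sup_ubound _); last first.
    exists (c_lo u); last by [].
    case: uV => clu _ G0; split=> [i|]; first by case/andP: (clu i).
    exists (fun=> 0); split=> [i|i|]; first by rewrite mulr0 addr0.
      by rewrite lexx ler01.
    by rewrite big1.
  by rewrite empty image_set0 ereal_inf0.
have [s [p [q [y1 [y2 [/v_le v_t xy le_t]]]]]] :=
  candidate_le_worst_cost uV bx feas.
apply: le_trans v_t (le_trans _ le_t).
by apply: ereal_inf_lbound; exists (x, y1, y2).
Qed.

Lemma robust_value_le s p q : (s, (p, q)) \in triples u ->
  (robust_value N u <= typeT_value N (candidate u s p q))%E.
Proof.
case/triplesP => sQ pQ qQ.
apply: le_ereal_inf_tmp => _ [[[x y1] y2] xy <-].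
have Q0 := thresholds_ge0 uV.
apply: (@le_trans _ _ (worst_cost N u x)); last first.
  by apply: worst_cost_le_candidate => //; exact: Q0.
by apply: ereal_inf_lbound; exists x => //; case: xy => _ _ [].
Qed.

Lemma robust_value_candidates : robust_value N u =
  \big[Order.min/+oo%E]_(t <- triples u) typeT_value N (candidate u t.1 t.2.1 t.2.2).
Proof.
apply/eqP; rewrite eq_le; apply/andP; split.
  rewrite big_seq; apply: le_bigmin => [|[s [p q]]]; [exact: leey|exact: robust_value_le].
apply: robust_value_ge => s p q spq.
pose val (t : R * (R * R)) := typeT_value N (candidate u t.1 t.2.1 t.2.2).
exact: (bigmin_inf_seq _ (s, (p, q)) xpredT _ val).
Qed.

End RobustValue.

Lemma robust_value_reduction (R : realType) : exists N1 N2 : nat -> nat,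
    big_O N1 (fun n => n ^ 2)%N /\ big_O N2 (fun n => n ^ 3)%N /\
    forall (n : nat) (u : budgeted R n), budgeted_valid u ->
    exists (k1 k2 : nat) (p : 'I_k1 -> 'cV[R]_n * R) (t : 'I_k2 -> typeT R n),
      (k1 <= N1 n)%N /\ (k2 <= N2 n)%N /\
      (forall j, typeT_valid (t j)) /\
      forall N : nominal R n, is_integral (relaxation N) ->
        robust_value N u =
          Order.min (\big[Order.min/+oo%E]_(j < k1) nominal_value N (p j))
                    (\big[Order.min/+oo%E]_(j < k2) typeT_value N (t j)).
Proof.
exists (fun=> 0%N), (fun n => n.*2.+1 ^ 3)%N; split; first by exists 0%N, 0%N.
split.
  exists (3 ^ 3)%N, 1%N => n n1.
  by rewrite -expnMn leq_exp2r //; lia.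
move=> n u uV.
pose T (t : R * (R * R)) := candidate u t.1 t.2.1 t.2.2.
(* No nominal problems: weight one covers them within type (T). *)
exists 0%N, (size (triples u)), (fun=> (0, 0)), (T \o tnth (in_tuple (triples u))).
split=> //; split; first by rewrite size_triples.
split=> [j|N _].
  have : tnth (in_tuple (triples u)) j \in triples u by exact: mem_tnth.
  rewrite /= /T; case: (tnth _ _) => s [p q] /triplesP[sQ _ _].
  by apply: candidate_valid => //; exact: thresholds_ge0 sQ.
rewrite big_ord0 min_r ?leey // (robust_value_candidates N uV).
exact: (big_tnth _ _ (triples u) xpredT (typeT_value N \o T)).
Qed.

(** * Bit sizes and the cost of executions *)

Section Bits.
Local Open Scope nat_scope.

Lemma bits_gt0 k : 0 < bits k. Proof. by []. Qed.

Lemma ltn_bits k : k < 2 ^ bits k. Proof. exact: trunc_log_ltn. Qed.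

Lemma bits_le k b : 0 < b -> k < 2 ^ b -> bits k <= b.
Proof.
case: b => // b _ kb; rewrite ltnS; case: k kb => [|k] kb; first by rewrite trunc_log0.
by rewrite -ltnS -(ltn_exp2l _ _ (ltnSn 1)); apply: leq_ltn_trans kb; apply: trunc_logP.
Qed.

Lemma leq_bits m n : m <= n -> bits m <= bits n.
Proof. by move=> mn; rewrite bits_le //; apply: leq_ltn_trans mn (ltn_bits n). Qed.

Lemma bitsM m n : bits (m * n) <= bits m + bits n.
Proof.
rewrite bits_le ?addn_gt0 // expnD; have [m2 n2] := (ltn_bits m, ltn_bits n).
by case: m m2 => [|m] m2; rewrite ?mul0n ?muln_gt0 ?expn_gt0 // ltn_mul.
Qed.

Lemma bitsD m n : bits (m + n) <= bits m + bits n.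
Proof.
rewrite bits_le ?addn_gt0 //; have [m2 n2] := (ltn_bits m, ltn_bits n).
have [bm bn] : 1 <= 2 ^ (bits m).-1 /\ 1 <= 2 ^ (bits n).-1 by rewrite !expn_gt0.
by move: m2 n2; rewrite expnD -(prednK (bits_gt0 m)) -(prednK (bits_gt0 n)) !expnS; nia.
Qed.

Lemma dsize_gt2 x : 2 < dsize x.
Proof.
elim: x => [q|a a2 b b2] /=; last by rewrite ltnS ltnW // (leq_trans a2) ?leq_addr.
by rewrite /bits; lia.
Qed.

(** Reducing a fraction does not increase numerator or denominator.  A zero
denominator gives the number 0, which is small enough as well. *)
Lemma dsize_frac (n d : int) :
  dsize (Atom (n%:~R / d%:~R)) <= (bits `|n| + bits `|d|).+1.
Proof.
rewrite /dsize; case: divqP => [_|k x k0]; first by rewrite ltnS leq_add.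
rewrite ltnS !abszM leq_add // leq_bits // leq_pmull // absz_gt0 //.
Qed.

Lemma dsize_ratD p q :
  dsize (Atom (p + q)) <=
    2 * (bits `|numq p| + bits `|denq p| + (bits `|numq q| + bits `|denq q|)).+1.
Proof.
have -> : (p + q)%R = ((numq p * denq q + numq q * denq p)%:~R / (denq p * denq q)%:~R)%R.
  rewrite -{1}(divq_num_den p) -{1}(divq_num_den q) rmorphD !rmorphM /=.
  by rewrite addf_div ?intr_eq0 ?denq_neq0.
apply: leq_trans (dsize_frac _ _) _.
have := bitsM `|denq p| `|denq q|; rewrite -abszM.
have absD : `|(numq p * denq q + numq q * denq p)%R| <=
    `|(numq p * denq q)%R| + `|(numq q * denq p)%R| by lia.
have := leq_trans (leq_bits absD) (bitsD _ _).
have := bitsM `|numq p| `|denq q|; rewrite -abszM.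
have := bitsM `|numq q| `|denq p|; rewrite -abszM.
lia.
Qed.

Lemma dsize_ratM p q :
  dsize (Atom (p * q)) <=
    (bits `|numq p| + bits `|denq p| + (bits `|numq q| + bits `|denq q|)).+1.
Proof.
have -> : (p * q)%R = ((numq p * numq q)%:~R / (denq p * denq q)%:~R)%R.
  rewrite -{1}(divq_num_den p) -{1}(divq_num_den q) !rmorphM /=.
  by rewrite mulf_div.
apply: leq_trans (dsize_frac _ _) _.
have := bitsM `|denq p| `|denq q|; rewrite -abszM.
have := bitsM `|numq p| `|numq q|; rewrite -abszM.
lia.
Qed.

(** Only a constant can produce an output whose size is not comparable with the
size of the input; the factor 2 accounts for the numerator and denominator of a sum. *)
Definition op_growth (o : op) : nat := if o is Const d then dsize d else 2.

Lemma dsize_op o x : dsize (op_eval o x) <= op_growth o * dsize x.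
Proof.
have x3 := dsize_gt2 x; have a0 : dsize (Atom 0) = 3 by [].
have a1 : dsize (Atom 1) = 3 by [].
have small : 3 <= 2 * dsize x by lia.
case: o => [|d|||||||] /=.
- lia.
- by rewrite leq_pmulr //; lia.
- by case: x {x3} small => [q|a b] small; rewrite // /dsize -/dsize; lia.
- by case: x {x3} small => [q|a b] small; rewrite // /dsize -/dsize; lia.
- by case: x {x3} small.
- case: x {x3} small => [q|[p|a b] [q|c d]] small //.
  apply: leq_trans (dsize_ratD _ _) _; rewrite /dsize; lia.
- case: x {x3} small => [q|a b] small //.
  by rewrite /dsize numqN denqN abszN; lia.
- case: x {x3} small => [q|[p|a b] [q|c d]] small //.
  apply: leq_trans (dsize_ratM _ _) _; rewrite /dsize; lia.
- case: x {x3} small => [q|a b] small //.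
  rewrite -{1}(divq_num_den q) invf_div; apply: leq_trans (dsize_frac _ _) _.
  rewrite /dsize; lia.
Qed.

(** The factor of a loop can be 1, whatever its body: the output of the loop is
the input of the last test, which is charged for reading it. *)
Fixpoint growth (p : prog) : nat :=
  match p with
  | Op o => op_growth o
  | Fork p q => (growth p + growth q).+1
  | Seq _ q => growth q
  | If _ p q => growth p + growth q
  | While _ _ => 1
  end.

Lemma exec_ge_input p x t y : exec p x t y -> dsize x <= t.
Proof. by elim; intros; lia. Qed.

(** Every step is charged for its input, so a cheap execution cannot have
produced large intermediate results. *)
Lemma exec_output p x t y : exec p x t y -> dsize y <= growth p * t.
Proof.
elim=> {p x t y} /=.
- exact: dsize_op.
- move=> p q x s t y z ep yp eq zq; have := exec_ge_input ep; have := dsize_gt2 x; nia.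
- by intros; nia.
- by intros; nia.
- by intros; nia.
- by move=> c p x s b ec _ _; rewrite mul1n (exec_ge_input ec).
- by intros; nia.
Qed.

End Bits.

(** * Polynomial-time computations *)

Section Ptime.
Local Open Scope nat_scope.

(** Bounds are pure powers of the size.  As sizes are at least 3, constants and
sums are absorbed into the exponent, and the class is closed under
composition. *)
Definition pbound (J : Type) (P : J -> Prop) (a : J -> data) (g : J -> nat) : Prop :=
  exists k, forall j, P j -> g j <= dsize (a j) ^ k.

(** One program, with one polynomial bound, that works for all indices.  The
output is attached to the index rather than to the input, so that no
decoding of inputs is ever required: a function on instances with a semantic
description can serve as [b].  The input [a] acts as a context from which
all intermediate results are computed. *)
Definition ptime (J : Type) (P : J -> Prop) (a b : J -> data) : Prop :=
  exists p k, forall j, P j ->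
    exists2 t, exec p (a j) t (b j) & t <= dsize (a j) ^ k.

Lemma leq_pow2 m k l : 2 < m -> k <= l -> m ^ k <= m ^ l.
Proof. by move=> m2 kl; rewrite leq_pexp2l // ltnW // ltnW. Qed.

Section Closure.
Variables (J : Type) (P : J -> Prop).
Implicit Types (a b c d : J -> data) (f g : J -> nat).

Lemma pbound_le a f g : (forall j, P j -> f j <= g j) ->
  pbound P a g -> pbound P a f.
Proof. by move=> fg [k gk]; exists k => j Pj; apply: leq_trans (fg j Pj) (gk j Pj). Qed.

Lemma pbound_size a : pbound P a (fun j => dsize (a j)).
Proof. by exists 1 => j _; rewrite expn1. Qed.

Lemma pbound_cst a n : pbound P a (fun=> n).
Proof.
exists n => j _; case: n => // n; apply: leq_trans (ltnW (ltn_expl n.+1 (ltnSn 1))) _.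
by rewrite leq_exp2r // ltnW ?dsize_gt2.
Qed.

Lemma pboundM a f g : pbound P a f -> pbound P a g -> pbound P a (fun j => f j * g j).
Proof.
by move=> [k fk] [l gl]; exists (k + l) => j Pj; rewrite expnD leq_mul ?fk ?gl.
Qed.

Lemma pboundD a f g : pbound P a f -> pbound P a g -> pbound P a (fun j => f j + g j).
Proof.
move=> [k fk] [l gl]; exists (k + l).+1 => j Pj; have a2 := dsize_gt2 (a j).
have fM := leq_trans (fk j Pj) (leq_pow2 a2 (leq_addr l k)).
have gM := leq_trans (gl j Pj) (leq_pow2 a2 (leq_addl k l)).
apply: leq_trans (leq_add fM gM) _.
by rewrite addnn -mul2n expnS leq_mul2r ltnW ?orbT.
Qed.

Lemma pboundX a f e : pbound P a f -> pbound P a (fun j => f j ^ e).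
Proof.
move=> fb; elim: e => [|e IH]; first exact: (pbound_cst a 1).
by apply: pbound_le (pboundM fb IH) => j _; rewrite expnS.
Qed.

Lemma pbound_comp a b f : pbound P a (fun j => dsize (b j)) -> pbound P b f -> pbound P a f.
Proof.
move=> [k bk] [l fl]; exists (k * l) => j Pj; apply: leq_trans (fl j Pj) _.
by rewrite expnM; case: l {fl} => // l; rewrite leq_exp2r // bk.
Qed.

Lemma ptime_size a b : ptime P a b -> pbound P a (fun j => dsize (b j)).
Proof.
move=> [p [k pk]]; apply: (pbound_le (g := fun j => growth p * dsize (a j) ^ k)).
  move=> j Pj; have [t e tk] := pk j Pj.
  by apply: leq_trans (exec_output e) _; rewrite leq_mul2l tk orbT.
by apply: pboundM; [exact: pbound_cst | exists k].
Qed.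

Lemma ptime_pbound a b p f : pbound P a f ->
  (forall j, P j -> exists2 t, exec p (a j) t (b j) & t <= f j) -> ptime P a b.
Proof.
move=> [k fk] ef; exists p, k => j Pj; have [t e tf] := ef j Pj.
by exists t => //; apply: leq_trans tf (fk j Pj).
Qed.

Lemma ptime_ext a b b' : (forall j, P j -> b j = b' j) -> ptime P a b -> ptime P a b'.
Proof. by move=> bb [p [k pk]]; exists p, k => j Pj; rewrite -bb //; apply: pk. Qed.

Lemma ptime_comp b a c : ptime P a b -> ptime P b c -> ptime P a c.
Proof.
move=> ab [q [l ql]]; have bsize := ptime_size ab; case: ab => p [k pk].
apply: (@ptime_pbound _ _ (Seq p q) (fun j => dsize (a j) ^ k + dsize (b j) ^ l)).
  apply: pboundD; first by exists k.
  by apply: pbound_comp bsize _; exists l.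
move=> j Pj; have [s e1 sk] := pk j Pj; have [t e2 tl] := ql j Pj.
by exists (s + t); [exact: exec_seq e1 e2 | exact: leq_add].
Qed.

Lemma ptime_op o a b : ptime P a b -> ptime P a (fun j => op_eval o (b j)).
Proof.
move=> ab; apply: ptime_comp ab _; exists (Op o), 1 => j _.
by exists (dsize (b j)); [exact: exec_op | rewrite expn1].
Qed.

Lemma ptime_id a : ptime P a a.
Proof.
by exists (Op Id), 1 => j _; exists (dsize (a j)); [exact: exec_op | rewrite expn1].
Qed.

Lemma ptime_cst a x : ptime P a (fun=> x).
Proof. exact: (ptime_op (Const x) (ptime_id a)). Qed.

Lemma ptime_pair a b c : ptime P a b -> ptime P a c ->
  ptime P a (fun j => Pair (b j) (c j)).
Proof.
move=> [p [k pk]] [q [l ql]].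
apply: (@ptime_pbound _ _ (Fork p q) (fun j => dsize (a j) ^ k + dsize (a j) ^ l)).
  by apply: pboundD; [exists k | exists l].
move=> j Pj; have [s e1 sk] := pk j Pj; have [t e2 tl] := ql j Pj.
by exists (s + t); [exact: exec_fork e1 e2 | exact: leq_add].
Qed.

Lemma ptime_fst a b c : ptime P a (fun j => Pair (b j) (c j)) -> ptime P a b.
Proof. exact: (ptime_op Fst). Qed.

Lemma ptime_snd a b c : ptime P a (fun j => Pair (b j) (c j)) -> ptime P a c.
Proof. exact: (ptime_op Snd). Qed.

Lemma ptime_if a (t : J -> data) b c : ptime P a t -> ptime P a b -> ptime P a c ->
  ptime P a (fun j => if truthy (t j) then b j else c j).
Proof.
move=> [r [m rm]] [p [k pk]] [q [l ql]].
apply: (@ptime_pbound _ _ (If r p q)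
  (fun j => dsize (a j) ^ m + (dsize (a j) ^ k + dsize (a j) ^ l))).
  by apply: pboundD; [exists m | apply: pboundD; [exists k | exists l]].
move=> j Pj; have [v e0 vm] := rm j Pj.
have [tt|tf] := boolP (truthy (t j)).
  have [s e1 sk] := pk j Pj; exists (v + s); first exact: exec_if_true e0 tt e1.
  by rewrite leq_add // (leq_trans sk) ?leq_addr.
have [s e2 sl] := ql j Pj; exists (v + s); first exact: exec_if_false e0 tf e2.
by rewrite leq_add // (leq_trans sl) ?leq_addl.
Qed.

Lemma ptime_ratD a (p q : J -> rat) :
  ptime P a (fun j => Atom (p j)) -> ptime P a (fun j => Atom (q j)) ->
  ptime P a (fun j => Atom (p j + q j)%R).
Proof. by move=> ap aq; apply: (ptime_op Add) (ptime_pair ap aq). Qed.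

Lemma ptime_ratM a (p q : J -> rat) :
  ptime P a (fun j => Atom (p j)) -> ptime P a (fun j => Atom (q j)) ->
  ptime P a (fun j => Atom (p j * q j)%R).
Proof. by move=> ap aq; apply: (ptime_op Mul) (ptime_pair ap aq). Qed.

Lemma ptime_ratB a (p q : J -> rat) :
  ptime P a (fun j => Atom (p j)) -> ptime P a (fun j => Atom (q j)) ->
  ptime P a (fun j => Atom (p j - q j)%R).
Proof. by move=> ap aq; apply: ptime_ratD ap (ptime_op Opp aq). Qed.

Lemma ptime_ratV a (p : J -> rat) :
  ptime P a (fun j => Atom (p j)) -> ptime P a (fun j => Atom (p j)^-1%R).
Proof. exact: (ptime_op Defs.Inv). Qed.

Lemma ptime_if_lt a (p q : J -> rat) b c :
  ptime P a (fun j => Atom (p j)) -> ptime P a (fun j => Atom (q j)) ->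
  ptime P a b -> ptime P a c ->
  ptime P a (fun j => if (p j < q j)%R then b j else c j).
Proof.
move=> ap aq ab ac; apply: ptime_ext (ptime_if (ptime_ratB aq ap) ab ac) => j _.
by rewrite /= subr_gt0.
Qed.

End Closure.

(** The indices only serve the specification, so they may be exchanged along any
relation that preserves input and output. *)
Lemma ptime_reindex_rel (J K : Type) (Q : K -> Prop) (P : J -> Prop) a b a' b' :
  (forall i, Q i -> exists j, [/\ P j, a j = a' i & b j = b' i]) ->
  ptime P a b -> ptime Q a' b'.
Proof. by move=> QP [p [k pk]]; exists p, k => i /QP[j [/pk + <- <-]]. Qed.

Lemma ptime_reindex (J K : Type) (h : K -> J) (Q : K -> Prop) (P : J -> Prop) a b :
  (forall i, Q i -> P (h i)) -> ptime P a b ->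
  ptime Q (fun i => a (h i)) (fun i => b (h i)).
Proof. by move=> QP; apply: ptime_reindex_rel => i /QP Pi; exists (h i). Qed.

Lemma exec_while c p (st : nat -> data) (test : nat -> data) (T : nat) m i :
  (forall l, l <= m -> exists2 t, exec c (st l) t (test l) & t <= T) ->
  (forall l, l <= m -> truthy (test l) = (l < m)) ->
  (forall l, l < m -> exists2 t, exec p (st l) t (st l.+1) & t <= T) ->
  i <= m -> exists2 t, exec (While c p) (st i) t (st m) & t <= (m - i) * (T + T) + T.
Proof.
move=> ct tE pt; move di : (m - i) => d; elim: d i di => [|d IH] i di im.
  have -> : i = m by lia.
  have [t e tT] := ct _ (leqnn m); exists t => //.
  by apply: exec_while_false e _; rewrite tE // ltnn.
have lt_im : i < m by lia.
have [t1 e1 l1] := ct _ im; have [t2 e2 l2] := pt _ lt_im.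
have [|//|t3 e3 l3] := IH i.+1; first by lia.
exists (t1 + t2 + t3); last by rewrite mulSn; lia.
by apply: exec_while_true e1 _ e2 e3; rewrite tE.
Qed.

(** The iterates must be bounded by a polynomial [g] in the initial state: a
polynomial bound per step alone would compound over the iterations. *)
Lemma ptime_loop (J : Type) (P : J -> Prop) (m : J -> nat) (st : J -> nat -> data)
    (test : J * nat -> data) :
  ptime (fun ji : J * nat => P ji.1 /\ ji.2 <= m ji.1) (fun ji => st ji.1 ji.2) test ->
  (forall j i, P j -> i <= m j -> truthy (test (j, i)) = (i < m j)) ->
  ptime (fun ji : J * nat => P ji.1 /\ ji.2 < m ji.1) (fun ji => st ji.1 ji.2)
    (fun ji => st ji.1 ji.2.+1) ->
  pbound P (fun j => st j 0) m ->
  (exists2 g, pbound P (fun j => st j 0) g &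
    forall j i, P j -> i <= m j -> dsize (st j i) <= g j) ->
  ptime P (fun j => st j 0) (fun j => st j (m j)).
Proof.
move=> [c [k ck]] tE [p [l pl]] mb [g gb gE].
pose T j := g j ^ k + g j ^ l.
apply: (@ptime_pbound _ _ _ _ (While c p) (fun j => m j * (T j + T j) + T j)).
  have Tb : pbound P (fun j => st j 0) T by apply: pboundD; exact: pboundX.
  by apply: pboundD => //; apply: pboundM => //; exact: pboundD.
move=> j Pj; rewrite -{2}[m j]subn0.
have pow_le i e : i <= m j -> dsize (st j i) ^ e <= g j ^ e.
  by move=> im; case: e => // e; rewrite leq_exp2r // gE.
apply: (@exec_while c p (st j) (fun i => test (j, i))) => // [i im|i im|i im].
- have [t e te] := ck (j, i) (conj Pj im); exists t => //.
  by apply: leq_trans te (leq_trans (pow_le _ _ im) (leq_addr _ _)).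
- exact: tE.
- have [t e te] := pl (j, i) (conj Pj im); exists t => //.
  by apply: leq_trans te (leq_trans (pow_le _ _ (ltnW im)) (leq_addl _ _)).
Qed.

End Ptime.

(** * List programs *)

Section Lists.
Local Open Scope nat_scope.

Definition code_list (s : seq data) : data := foldr Pair (Atom 0) s.

Definition lsize (s : seq data) : nat := sumn [seq (dsize x).+1 | x <- s].

Lemma dsize_code_list s : dsize (code_list s) = lsize s + 3.
Proof. by elim: s => //= x s ->; rewrite /lsize /= addSn addnA. Qed.

Lemma lsize_cat s t : lsize (s ++ t) = lsize s + lsize t.
Proof. by rewrite /lsize map_cat sumn_cat. Qed.

Lemma lsize_rev s : lsize (rev s) = lsize s.
Proof. by rewrite /lsize map_rev sumn_rev. Qed.

Lemma size_lsize s : size s <= lsize s.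
Proof. by elim: s => //= x s IH; rewrite /lsize /= addSn ltnS (leq_trans IH) ?leq_addl. Qed.

(** One step of a traversal: entry [i] moves from the part still to be read to
the part already read. *)
Lemma split_at (K : Type) (s : seq K) i : i < size s -> exists k s2,
  [/\ drop i s = k :: s2, drop i.+1 s = s2, take i.+1 s = rcons (take i s) k
    & s = take i s ++ k :: s2].
Proof.
case: s => // k0 s il; exists (nth k0 (k0 :: s) i), (drop i.+1 (k0 :: s)); split=> //.
- exact: drop_nth.
- exact: take_nth.
- by rewrite -drop_nth // cat_take_drop.
Qed.

Section Fold.
Variables (J K : Type) (P : J -> Prop) (a : J -> data) (l : J -> seq K) (cell : K -> data).

(** The accumulator is specified by the prefix read so far, and the step may use
that this prefix and the current entry start the list.  The context [a] stays
available throughout the traversal. *)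
Lemma ptime_fold (acc : J -> seq K -> data) :
  ptime P a (fun j => code_list (map cell (l j))) ->
  ptime P a (fun j => acc j [::]) ->
  ptime (fun jsk : J * (seq K * K) => P jsk.1 /\
           exists s, l jsk.1 = jsk.2.1 ++ jsk.2.2 :: s)
    (fun jsk => Pair (Pair (a jsk.1) (cell jsk.2.2)) (acc jsk.1 jsk.2.1))
    (fun jsk => acc jsk.1 (rcons jsk.2.1 jsk.2.2)) ->
  (exists2 g, pbound P a g &
    forall j s s', P j -> l j = s ++ s' -> dsize (acc j s) <= g j) ->
  ptime P a (fun j => acc j (l j)).
Proof.
move=> al acc0 step [g gb gE].
pose rest (ji : J * nat) := code_list (map cell (drop ji.2 (l ji.1))).
pose st j i := Pair (Pair (a j) (rest (j, i))) (acc j (take i (l j))).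
have a_st0 (f : J -> nat) : pbound P a f -> pbound P (fun j => st j 0) f.
  apply: pbound_comp; apply: ptime_size (ptime_fst (ptime_fst (ptime_id _ _))).
apply: (ptime_ext (b := fun j => acc j (take (size (l j)) (l j)))).
  by move=> j _; rewrite take_size.
apply: (ptime_comp (b := fun j => st j (size (l j)))); last exact: ptime_snd (ptime_id _ _).
(* The loop state holds the context, the entries still to be read, and the
accumulator. *)
apply: (ptime_comp (b := fun j => st j 0)).
  apply: ptime_pair (ptime_pair (ptime_id _ _) _) _.
    by apply: ptime_ext al => j _; rewrite /rest drop0.
  by apply: ptime_ext acc0 => j _; rewrite take0.
apply: (@ptime_loop _ _ _ _
  (fun ji => if truthy (op_eval IsAtom (rest ji)) then Atom 0 else Atom 1)).
- apply: ptime_if (ptime_cst _ _ _) (ptime_cst _ _ _).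
  apply: ptime_op; apply: ptime_ext (ptime_snd (ptime_fst (ptime_id _ _))).
  by case.
- move=> j i _ il; rewrite /rest /=.
  case: ltnP => il'; last by rewrite drop_oversize.
  by have [k [s [-> _ _ _]]] := split_at il'.
- have now := ptime_id (fun ji : J * nat => P ji.1 /\ ji.2 < size (l ji.1))
    (fun ji => st ji.1 ji.2).
  have nowa := ptime_fst (ptime_fst now).
  have nowrest := ptime_snd (ptime_fst now).
  apply: ptime_pair (ptime_pair nowa _) _.
    apply: ptime_ext (ptime_op Snd nowrest) => -[j i] [_ il].
    by rewrite /rest /=; have [k [s [-> -> _ _]]] := split_at il.
  apply: ptime_comp (ptime_pair (ptime_pair nowa (ptime_op Fst nowrest)) (ptime_snd now)) _.
  apply: ptime_reindex_rel step => -[j i] /= [Pj il].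
  have [k [s [e1 e2 e3 e4]]] := split_at il.
  exists (j, (take i (l j), k)); rewrite /rest /= e1 e3; split=> //.
  by split=> //; exists s.
- apply: a_st0; apply: pbound_le (ptime_size al) => j _.
  by rewrite dsize_code_list -(size_map cell) (leq_trans (size_lsize _)) ?leq_addr.
- exists (fun j => dsize (a j) + dsize (code_list (map cell (l j))) + g j + 2).
    apply: a_st0; apply: pboundD; last exact: pbound_cst.
    by apply: pboundD => //; apply: pboundD; [exact: pbound_size | exact: ptime_size].
  move=> j i Pj il; rewrite /st /rest /= !dsize_code_list.
  have := gE j (take i (l j)) (drop i (l j)) Pj (esym (cat_take_drop _ _)).
  have := congr1 (fun s => lsize (map cell s)) (cat_take_drop i (l j)).
  by rewrite /= map_cat lsize_cat; lia.
Qed.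
End Fold.

Section Combinators.
Variables (J : Type) (P : J -> Prop) (a : J -> data).

Lemma ptime_list (l : J -> seq data) : ptime P a (fun j => code_list (l j)) ->
  ptime P a (fun j => code_list (map id (l j))).
Proof. by apply: ptime_ext => j _; rewrite map_id. Qed.

Lemma ptime_cons (x : J -> data) (l : J -> seq data) : ptime P a x ->
  ptime P a (fun j => code_list (l j)) -> ptime P a (fun j => code_list (x j :: l j)).
Proof. exact: ptime_pair. Qed.

Lemma ptime_catrev (l m : J -> seq data) :
  ptime P a (fun j => code_list (l j)) -> ptime P a (fun j => code_list (m j)) ->
  ptime P a (fun j => code_list (catrev (l j) (m j))).
Proof.
move=> al am.
apply: (ptime_fold (cell := id) (acc := fun j s => code_list (catrev s (m j))))
  => //; first exact: ptime_list.
  set Q := fun jsk : J * (seq data * data) => _.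
  pose now jsk : data := Pair (Pair (a jsk.1) jsk.2.2) (code_list (catrev jsk.2.1 (m jsk.1))).
  have nows : ptime Q now now by exact: ptime_id.
  apply: ptime_ext (ptime_pair (ptime_snd (ptime_fst nows)) (ptime_snd nows)) => -[j [s k]] _ /=.
  by rewrite !catrevE rev_rcons.
exists (fun j => dsize (code_list (l j)) + dsize (code_list (m j))).
  by apply: pboundD; apply: ptime_size.
move=> j s s' _ ->; rewrite catrevE !dsize_code_list !lsize_cat lsize_rev; lia.
Qed.

Lemma ptime_rev (l : J -> seq data) : ptime P a (fun j => code_list (l j)) ->
  ptime P a (fun j => code_list (rev (l j))).
Proof. by move=> al; exact: (ptime_catrev (m := fun=> [::])) al (ptime_cst _ _ _). Qed.

Lemma ptime_cat (l m : J -> seq data) :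
  ptime P a (fun j => code_list (l j)) -> ptime P a (fun j => code_list (m j)) ->
  ptime P a (fun j => code_list (l j ++ m j)).
Proof.
move=> al am; apply: ptime_ext (ptime_catrev (ptime_rev al) am) => j _.
by rewrite catrevE revK.
Qed.

Variable K : Type.
Implicit Types (l : J -> seq K) (cell : K -> data).

(** The accumulator carries the unread part of the second list. *)
Lemma ptime_zip l cell1 cell2 :
  ptime P a (fun j => code_list (map cell1 (l j))) ->
  ptime P a (fun j => code_list (map cell2 (l j))) ->
  ptime P a (fun j => code_list [seq Pair (cell1 k) (cell2 k) | k <- l j]).
Proof.
move=> al1 al2; pose pair k := Pair (cell1 k) (cell2 k).
have lsize_pair s : lsize (map pair s) = lsize (map cell1 s) + lsize (map cell2 s).
  by elim: s => //= k s; rewrite /lsize /= => ->; lia.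
pose acc j s := Pair (code_list (map cell2 (drop (size s) (l j)))) (code_list (rev (map pair s))).
suff al : ptime P a (fun j => acc j (l j)).
  apply: ptime_ext (ptime_rev (ptime_snd al)) => j _; by rewrite revK.
apply: (ptime_fold al1).
- apply: ptime_pair (ptime_cst _ _ _).
  by apply: ptime_ext al2 => j _; rewrite drop0.
- set Q := fun jsk : J * (seq K * K) => _.
  pose now jsk : data := Pair (Pair (a jsk.1) (cell1 jsk.2.2)) (acc jsk.1 jsk.2.1).
  have nows : ptime Q now now by exact: ptime_id.
  have rest := ptime_fst (ptime_snd nows); have x := ptime_snd (ptime_fst nows).
  apply: ptime_ext (ptime_pair (ptime_op Snd rest)
    (ptime_pair (ptime_pair x (ptime_op Fst rest)) (ptime_snd (ptime_snd nows)))).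
  move=> [j [s k]] [_ [s2 /= ls]]; rewrite /acc map_rcons rev_rcons size_rcons.
  have -> : drop (size s).+1 (l j) = s2.
    by rewrite ls -cat_rcons -(size_rcons s k) drop_size_cat.
  by rewrite ls drop_size_cat.
- exists (fun j => dsize (code_list (map cell1 (l j))) + dsize (code_list (map cell2 (l j))) + 10).
    apply: pboundD; last exact: pbound_cst.
    by apply: pboundD; [exact: ptime_size al1 | exact: ptime_size al2].
  move=> j s s' _ ls; rewrite /acc /= ls drop_size_cat // !dsize_code_list lsize_rev lsize_pair.
  by rewrite !map_cat !lsize_cat; lia.
Qed.

End Combinators.

(** The partial results stay polynomial: each entry of the output is polynomial in
the context and one entry of the input, and the size of the list bounds the
number of entries. *)
Lemma ptime_map (J : Type) (K : eqType) (P : J -> Prop) (a : J -> data) (l : J -> seq K)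
    (cell : K -> data) (out : J * K -> data) :
  ptime P a (fun j => code_list (map cell (l j))) ->
  ptime (fun jk : J * K => P jk.1 /\ jk.2 \in l jk.1)
    (fun jk => Pair (a jk.1) (cell jk.2)) out ->
  ptime P a (fun j => code_list [seq out (j, k) | k <- l j]).
Proof.
move=> al step; have [e outb] := ptime_size step.
pose acc j s := code_list (rev [seq out (j, k) | k <- s]).
suff aacc : ptime P a (fun j => acc j (l j)).
  by apply: ptime_ext (ptime_rev aacc) => j _; rewrite revK.
apply: (ptime_fold al); first exact: ptime_cst.
- set Q := fun jsk : J * (seq K * K) => _.
  pose now jsk : data := Pair (Pair (a jsk.1) (cell jsk.2.2)) (acc jsk.1 jsk.2.1).
  have nows : ptime Q now now by exact: ptime_id.
  apply: (ptime_ext (b := fun jsk => Pair (out (jsk.1, jsk.2.2)) (acc jsk.1 jsk.2.1))).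
    by move=> [j [s k]] _; rewrite /acc map_rcons rev_rcons.
  apply: ptime_pair (ptime_snd nows); apply: ptime_comp (ptime_fst nows) _.
  apply: ptime_reindex_rel step => -[j [s k]] [/= Pj [s' ls]].
  by exists (j, k); split=> //; split=> //; rewrite /= ls mem_cat mem_head orbT.
- pose L j := dsize (code_list (map cell (l j))).
  exists (fun j => L j * ((dsize (a j) + L j + 1) ^ e + 1) + 3).
    apply: pboundD; last exact: pbound_cst.
    have Lb : pbound P a L by exact: ptime_size al.
    apply: pboundM => //; apply: pboundD; last exact: pbound_cst.
    apply: pboundX; apply: pboundD; last exact: pbound_cst.
    by apply: pboundD; first exact: pbound_size.
  move=> j s s' Pj ls; rewrite /acc dsize_code_list lsize_rev leq_add2r.
  have szs : size s <= L j.
    rewrite /L dsize_code_list; apply: leq_trans (leq_addr _ _).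
    by apply: leq_trans (size_lsize _); rewrite size_map ls size_cat leq_addr.
  apply: leq_trans (leq_mul szs (leqnn _)).
  have {szs} : {in s, forall k, dsize (out (j, k)) <= (dsize (a j) + L j + 1) ^ e}.
    move=> k ks; have kl : k \in l j by rewrite ls mem_cat ks.
    apply: leq_trans (outb (j, k) (conj Pj kl)) _ => /=.
    case: (e) => // e'; rewrite leq_exp2r //.
    have : dsize (cell k) <= lsize (map cell (l j)).
      move: kl => /splitPr[s1 s2]; rewrite map_cat lsize_cat /lsize /=; lia.
    rewrite /L dsize_code_list; lia.
  elim: s {ls} => //= k s IH outk; rewrite /lsize /= mulSn leq_add //.
    by rewrite addn1 ltnS outk ?mem_head.
  by apply: IH => k' k's; rewrite outk // in_cons k's orbT.
Qed.

End Lists.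

(** * Selecting an optimal answer *)

Section Best.

(** An atom stands for infeasibility and loses against any solution; otherwise
the smaller value wins. *)
Definition pick (x y : data) : data :=
  if truthy (op_eval IsAtom y) then x
  else if truthy (op_eval IsAtom x) then y
  else if truthy (op_eval Add (Pair (op_eval Fst x) (op_eval Opp (op_eval Fst y))))
  then y else x.

Definition best (s : seq data) : data := foldl pick (Atom 0) s.

(** The shape on which [pick] compares values: an atom, or a pair that begins
with a number. *)
Definition is_answer (x : data) : bool :=
  if x is Pair (Pair _ _) _ then false else true.

Definition answer_value (R : realType) (x : data) : \bar R :=
  if x is Pair (Atom q) _ then (ratr q)%:E else +oo%E.

Lemma pick_ind (A : data -> Prop) x y : A x -> A y -> A (pick x y).
Proof. by rewrite /pick; case: ifP => _ //; case: ifP => _ //; case: ifP. Qed.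

Lemma pick_le (R : realType) x y : is_answer x -> is_answer y ->
  (answer_value R (pick x y) <= answer_value R x)%E /\
  (answer_value R (pick x y) <= answer_value R y)%E.
Proof.
case: y => [q|[q|? ?] b] //; first by rewrite /pick /=; split; rewrite ?leey ?lexx.
case: x => [p|[p|? ?] a] // _ _; first by rewrite /pick /=; split; rewrite ?leey ?lexx.
rewrite /pick /= subr_gt0; case: ltP => pq; rewrite /= !lee_fin !ler_rat lexx.
  by rewrite (ltW pq).
by rewrite pq.
Qed.

(** The selected answer is [Atom 0] or one of the given answers. *)
Lemma best_ind (A : data -> Prop) (K : eqType) (out : K -> data) (s : seq K) :
  A (Atom 0) -> (forall k, k \in s -> A (out k)) -> A (best (map out s)).
Proof.
rewrite /best; move: (Atom 0) => x; elim: s x => //= k s IH x Ax As.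
apply: IH; first by apply: pick_ind => //; apply: As; exact: mem_head.
by move=> k' k's; apply: As; rewrite in_cons k's orbT.
Qed.

Lemma best_le (R : realType) (K : eqType) (out : K -> data) (s : seq K) k :
  (forall k, k \in s -> is_answer (out k)) -> k \in s ->
  (answer_value R (best (map out s)) <= answer_value R (out k))%E.
Proof.
rewrite /best => As ks; have : is_answer (Atom 0) by [].
suff H x : is_answer x ->
    (answer_value R (foldl pick x (map out s)) <= answer_value R x)%E /\
    (k \in s -> (answer_value R (foldl pick x (map out s)) <= answer_value R (out k))%E).
  by case/H => _; apply.
elim: s As x {ks} => //= k' s IH As x Ax.
have Ak' : is_answer (out k') by apply: As; exact: mem_head.
have [lex lek'] := pick_le R Ax Ak'.
have [||le1 le2] := IH _ (pick x (out k')).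
- by move=> k2 k2s; apply: As; rewrite in_cons k2s orbT.
- exact: (@pick_ind is_answer).
split; first exact: le_trans lex.
by rewrite in_cons => /predU1P[->|//]; exact: le_trans lek'.
Qed.

Lemma ptime_pick (J : Type) (P : J -> Prop) a x y :
  ptime P a x -> ptime P a y -> ptime P a (fun j => pick (x j) (y j)).
Proof.
move=> ax ay; apply: (ptime_if (ptime_op IsAtom ay) ax).
apply: (ptime_if (ptime_op IsAtom ax) ay); apply: (ptime_if _ ay ax).
exact: (ptime_op Add) (ptime_pair (ptime_op Fst ax) (ptime_op Opp (ptime_op Fst ay))).
Qed.

Lemma ptime_best (J : Type) (P : J -> Prop) a (l : J -> seq data) :
  ptime P a (fun j => code_list (l j)) -> ptime P a (fun j => best (l j)).
Proof.
move=> al; apply: (ptime_fold (cell := id) (acc := fun=> best) (ptime_list al)).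
- exact: ptime_cst.
- set Q := fun jsk : J * (seq data * data) => _.
  pose now jsk : data := Pair (Pair (a jsk.1) jsk.2.2) (best jsk.2.1).
  have nows : ptime Q now now by exact: ptime_id.
  apply: ptime_ext (ptime_pick (ptime_snd nows) (ptime_snd (ptime_fst nows))).
  by move=> [j [s k]] _; rewrite /best /= -cats1 foldl_cat.
exists (fun j => dsize (code_list (l j))); first exact: ptime_size.
move=> j s s' _ ->; rewrite dsize_code_list lsize_cat /best.
suff H x : (dsize (foldl pick x s) <= maxn (dsize x) (lsize s))%N.
  by have := H (Atom 0); have -> : dsize (Atom 0) = 3 by []; lia.
elim: s x => [|y s IH] x; first by rewrite leq_max leqnn.
apply: leq_trans (IH _) _; rewrite /lsize /= geq_max; apply/andP; split; last by lia.
by apply: (@pick_ind (fun d => dsize d <= _)%N); lia.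
Qed.

Lemma ptime_best_map (J : Type) (K : eqType) (P : J -> Prop) (a : J -> data) (l : J -> seq K)
    (cell : K -> data) (out : J * K -> data) :
  ptime P a (fun j => code_list (map cell (l j))) ->
  ptime (fun jk : J * K => P jk.1 /\ jk.2 \in l jk.1)
    (fun jk => Pair (a jk.1) (cell jk.2)) out ->
  ptime P a (fun j => best [seq out (j, k) | k <- l j]).
Proof. by move=> al step; apply: ptime_best (ptime_map al step). Qed.

End Best.

(** Choosing an output for every instance turns a specification of correct
answers into a function to which the closure properties apply. *)
Lemma poly_time_ptime (I : Type) (valid : I -> Prop) code correct :
  poly_time valid code correct -> exists ans, ptime valid code ans /\
    forall i, valid i -> correct i (ans i).
Proof.
move=> [p [k pk]].
have [ans ansP] : {ans : I -> data & forall i, valid i ->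
    (exists2 t, exec p (code i) t (ans i) & (t <= k * dsize (code i) ^ k)%N) /\
    correct i (ans i)}.
  apply: (choice (P := fun i y => valid i ->
    (exists2 t, exec p (code i) t y & (t <= k * dsize (code i) ^ k)%N) /\ correct i y)) => i.
  have [vi|nvi] := pselect (valid i); last by exists (Atom 0).
  by have [t [y [e tk cy]]] := pk i vi; exists y => _; split=> //; exists t.
exists ans; split; last by move=> i /ansP[].
apply: ptime_pbound => [|i vi].
  apply: pboundM; first exact: (pbound_cst valid code k).
  by exists k => i _; exact: leqnn.
by have [? _] := ansP i vi; eassumption.
Qed.

Lemma ptime_poly_time (I : Type) (valid : I -> Prop) code correct ans :
  ptime valid code ans -> (forall i, valid i -> correct i (ans i)) ->
  poly_time valid code correct.
Proof.
move=> [p [k pk]] ok; exists p, k.+1 => i vi; have [t e tk] := pk i vi.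
exists t, (ans i); split=> //; last exact: ok.
by apply: leq_trans tk _; rewrite mulSn (leq_trans _ (leq_addr _ _)) // leq_pow2 // dsize_gt2.
Qed.

(** * Programs that build the problems of type (T) *)

Section Transfer.
Variables (R : realType) (n : nat) (u : budgeted rat n).
Local Notation ur := (real_budgeted R u).

Lemma ratr_excess w t : ratr (excess w t) = excess (ratr w) (ratr t) :> R.
Proof.
by rewrite /excess /Order.max -rmorphB ltrq0; case: ifP; rewrite ?rmorph0.
Qed.

Lemma real_price (lo up : 'cV[rat]_n) t :
  real_vec R (price lo up t) = price (real_vec R lo) (real_vec R up) (ratr t).
Proof. by apply/colP => i; rewrite !mxE rmorphD /= ratr_excess rmorphB. Qed.

(** All constructions use field operations and comparisons only, which the
embedding of the rationals preserves. *)
Lemma real_candidate s p q :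
  real_typeT R (candidate u s p q) = candidate ur (ratr s) (ratr p) (ratr q).
Proof.
have lowE : split_low (ratr p) (ratr s) (ratr q) = ratr (split_low p s q) :> R.
  by rewrite /split_low ler_rat ltr_rat; case: ifP.
have weightE : split_weight (ratr p) (ratr s) (ratr q) = ratr (split_weight p s q) :> R.
  rewrite /split_weight ler_rat ltr_rat; case: ifP => _; last by rewrite rmorph1.
  by rewrite fmorph_div !rmorphB.
have realZ a (v : 'cV[rat]_n) : real_vec R (a *: v) = ratr a *: real_vec R v.
  by apply/colP => i; rewrite !mxE rmorphM.
rewrite /real_typeT /candidate /= weightE lowE !realZ !real_price.
by rewrite rmorphM rmorphB rmorph1.
Qed.

Lemma real_thresholds : thresholds ur = map ratr (thresholds u).
Proof.
rewrite /thresholds /= rmorph0 map_cat -!map_comp; congr (_ :: _ ++ _);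
  by apply: eq_map => i; rewrite /= /gap !mxE rmorphB.
Qed.

Lemma real_budgeted_valid : budgeted_valid u -> budgeted_valid ur.
Proof.
move=> [clu dlu G0]; split=> [i|i|] /=; rewrite ?mxE -?[0 : R](rmorph0 (ratr : rat -> R)) ?ler_rat.
- exact: clu.
- exact: dlu.
- exact: G0.
Qed.

Lemma mem_real_triples s p q : (s, (p, q)) \in triples ur -> exists s' p' q',
  [/\ s' \in thresholds u, p' \in thresholds u, q' \in thresholds u &
      candidate ur s p q = real_typeT R (candidate u s' p' q')].
Proof.
case/triplesP; rewrite real_thresholds => /mapP[s' s'Q ->] /mapP[p' p'Q ->] /mapP[q' q'Q ->].
by exists s', p', q'; rewrite real_candidate.
Qed.

Lemma binary_real_vec (x : 'cV[rat]_n) : binary (real_vec R x) -> binary x.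
Proof.
move=> bx i; case: (bx i); rewrite mxE => /eqP.
  by rewrite fmorph_eq0 => /eqP; left.
by rewrite fmorph_eq1 => /eqP; right.
Qed.

End Transfer.

Section Data.

(** The two ranges of one item, in the order of the bounds in an instance.
Entries of vectors are computed item by item. *)
Definition item : eqType := (rat * rat * rat * rat)%type.

Definition code_item (k : item) : data :=
  Pair (Pair (Pair (Atom k.1.1.1) (Atom k.1.1.2)) (Atom k.1.2)) (Atom k.2).

Definition items n (u : budgeted rat n) : seq item :=
  [seq (c_lo u i 0, c_up u i 0, d_lo u i 0, d_up u i 0) | i <- enum 'I_n].

Lemma code_vecE n (v : 'cV[rat]_n) (u : budgeted rat n) (f : item -> rat) :
  (forall i, v i 0 = f (c_lo u i 0, c_up u i 0, d_lo u i 0, d_up u i 0)) ->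
  code_vec v = code_list [seq Atom (f k) | k <- items u].
Proof.
move=> vf; rewrite /code_vec /code_list -map_comp foldr_map.
by elim: (enum _) => //= i s ->; rewrite vf.
Qed.

Variables (L : Type) (Q : L -> Prop) (a : L -> data).
Variables (n : L -> nat) (u : forall l, budgeted rat (n l)) (w : L -> data).
Hypothesis a_instance : ptime Q a (fun l => code_robust (w l) (u l)).

Lemma ptime_budget : ptime Q a (fun l => Atom (budget (u l))).
Proof. by have := a_instance; do 5 move/ptime_snd. Qed.

Lemma ptime_items : ptime Q a (fun l => code_list (map code_item (items (u l)))).
Proof.
have vecs := ptime_snd a_instance; rewrite /code_robust in vecs.
pose ith (f : item -> rat) l := code_list [seq Atom (f k) | k <- items (u l)].
have cl : ptime Q a (ith (fun k => k.1.1.1)).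
  by apply: ptime_ext (ptime_fst vecs) => l _; exact: code_vecE.
have cu : ptime Q a (ith (fun k => k.1.1.2)).
  by apply: ptime_ext (ptime_fst (ptime_snd vecs)) => l _; exact: code_vecE.
have dl : ptime Q a (ith (fun k => k.1.2)).
  by apply: ptime_ext (ptime_fst (ptime_snd (ptime_snd vecs))) => l _; exact: code_vecE.
have du : ptime Q a (ith (fun k => k.2)).
  by apply: ptime_ext (ptime_fst (ptime_snd (ptime_snd (ptime_snd vecs)))) => l _; exact: code_vecE.
exact: ptime_zip (ptime_zip (ptime_zip cl cu) dl) du.
Qed.

Lemma ptime_over_items (out : L * item -> rat) :
  ptime (fun lk : L * item => Q lk.1) (fun lk => Pair (a lk.1) (code_item lk.2))
    (fun lk => Atom (out lk)) ->
  ptime Q a (fun l => code_list [seq Atom (out (l, k)) | k <- items (u l)]).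
Proof.
move=> step; apply: (ptime_map ptime_items (out := fun lk => Atom (out lk))).
by apply: ptime_reindex_rel step => lk [Ql _]; exists lk.
Qed.

Lemma ptime_thresholds : ptime Q a (fun l => code_list (map Atom (thresholds (u l)))).
Proof.
pose now (lk : L * item) := Pair (a lk.1) (code_item lk.2).
have k0 := ptime_snd (ptime_id (fun lk : L * item => Q lk.1) now).
have gaps_c := ptime_ratB (ptime_snd (ptime_fst (ptime_fst k0)))
  (ptime_fst (ptime_fst (ptime_fst k0))).
have gaps_d := ptime_ratB (ptime_snd k0) (ptime_snd (ptime_fst k0)).
apply: ptime_ext (ptime_cons (ptime_cst _ _ (Atom 0))
  (ptime_cat (ptime_over_items gaps_c) (ptime_over_items gaps_d))) => l _.
by rewrite /thresholds /= map_cat -!map_comp.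
Qed.

(** The selectors [lo] and [up] choose the stage within an item, so that one
program text serves both stages. *)
Lemma ptime_price (t wt : L -> rat) (lo up : item -> rat)
    (lov upv : forall l, 'cV[rat]_(n l)) :
  ptime Q a (fun l => Atom (t l)) -> ptime Q a (fun l => Atom (wt l)) ->
  ptime (fun=> True) code_item (fun k => Atom (lo k)) ->
  ptime (fun=> True) code_item (fun k => Atom (up k)) ->
  (forall l i, lov l i 0 = lo (c_lo (u l) i 0, c_up (u l) i 0, d_lo (u l) i 0, d_up (u l) i 0)) ->
  (forall l i, upv l i 0 = up (c_lo (u l) i 0, c_up (u l) i 0, d_lo (u l) i 0, d_up (u l) i 0)) ->
  ptime Q a (fun l => code_vec (wt l *: price (lov l) (upv l) (t l))).
Proof.
move=> at_ aw alo aup lovE upvE.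
pose Q' (lk : L * item) := Q lk.1.
pose now (lk : L * item) := Pair (a lk.1) (code_item lk.2).
have nowa : ptime Q' now (fun lk => a lk.1) by exact: ptime_fst (ptime_id _ _).
have nowk : ptime Q' now (fun lk => code_item lk.2) by exact: ptime_snd (ptime_id _ _).
have t' : ptime Q' now (fun lk => Atom (t lk.1)).
  by apply: ptime_comp nowa _; apply: ptime_reindex at_.
have w' : ptime Q' now (fun lk => Atom (wt lk.1)).
  by apply: ptime_comp nowa _; apply: ptime_reindex aw.
have lo' : ptime Q' now (fun lk => Atom (lo lk.2)).
  by apply: ptime_comp nowk _; apply: ptime_reindex alo.
have up' : ptime Q' now (fun lk => Atom (up lk.2)).
  by apply: ptime_comp nowk _; apply: ptime_reindex aup.
have d' := ptime_ratB (ptime_ratB up' lo') t'.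
have ex : ptime Q' now (fun lk => Atom (excess (up lk.2 - lo lk.2) (t lk.1))).
  apply: ptime_ext (ptime_if_lt d' (ptime_cst _ _ (Atom 0)) (ptime_cst _ _ (Atom 0)) d').
  by move=> lk _; rewrite /excess /Order.max; case: ifP.
apply: ptime_ext (ptime_over_items (ptime_ratM w' (ptime_ratD lo' ex))) => l _ /=.
by apply: esym; apply: code_vecE => i; rewrite !mxE lovE upvE.
Qed.

Lemma ptime_candidate (s p q : L -> rat) :
  ptime Q a (fun l => Atom (s l)) -> ptime Q a (fun l => Atom (p l)) ->
  ptime Q a (fun l => Atom (q l)) ->
  ptime Q a (fun l => code_typeT (w l) (candidate (u l) (s l) (p l) (q l))).
Proof.
move=> as_ ap aq.
have one := ptime_cst Q a (Atom 1).
have weight : ptime Q a (fun l => Atom (split_weight (p l) (s l) (q l))).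
  have frac := ptime_ratM (ptime_ratB aq as_) (ptime_ratV (ptime_ratB aq ap)).
  apply: ptime_ext (ptime_if_lt as_ ap one (ptime_if_lt as_ aq frac one)) => l _.
  by rewrite /split_weight; case: (ltP (s l) (p l)) => //= _; case: ifP.
have low : ptime Q a (fun l => Atom (split_low (p l) (s l) (q l))).
  apply: ptime_ext (ptime_if_lt as_ ap as_ (ptime_if_lt as_ aq ap as_)) => l _.
  by rewrite /split_low; case: (ltP (s l) (p l)) => //= _; case: ifP.
have k0 := ptime_id (fun=> True) code_item.
have clo := ptime_fst (ptime_fst (ptime_fst k0)).
have cup := ptime_snd (ptime_fst (ptime_fst k0)).
have dlo := ptime_snd (ptime_fst k0); have dup := ptime_snd k0.
have first := ptime_price as_ one clo cup
  (lov := fun l => c_lo (u l)) (upv := fun l => c_up (u l)) (fun=> fun=> erefl) (fun=> fun=> erefl).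
have second t wt at_ aw := @ptime_price t wt _ _
  (fun l => d_lo (u l)) (fun l => d_up (u l)) at_ aw dlo dup
  (fun=> fun=> erefl) (fun=> fun=> erefl).
apply: ptime_ext (ptime_pair (ptime_fst a_instance) (ptime_pair first
  (ptime_pair (second _ _ low weight)
    (ptime_pair (second _ _ aq (ptime_ratB one weight)) (ptime_ratM ptime_budget as_))))) => l _.
by rewrite scale1r.
Qed.

End Data.

(** * Solving the robust problem in polynomial time *)

Lemma typeT_answer_value (R : realType) n (N : nominal R n) (t : typeT rat n) r :
  typeT_answer N t r ->
  is_answer r /\ answer_value R r = typeT_value N (real_typeT R t).
Proof.
case=> [[empty ->]|[q [x [y1 [y2 [-> _ _ ->]]]]]]; split=> //=.
by rewrite /typeT_value empty image_set0 ereal_inf0.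
Qed.

(** Drops the second-stage decisions, which are not part of a solution of the
robust problem. *)
Definition robust_report (r : data) : data :=
  if truthy (op_eval IsAtom r) then Atom 0
  else Pair (op_eval Fst r) (op_eval Fst (op_eval Snd r)).

Section Solver.
Variables (R : realType) (I : Type) (n : I -> nat) (N : forall i, nominal R (n i)).
Variables (code : I -> data) (ans : {i : I & typeT rat (n i)} -> data).

Let J := {i : I & budgeted rat (n i)}.
Let u (j : J) := projT2 j.
Let P (j : J) := budgeted_valid (u j).
Let instance (j : J) := code_robust (code (projT1 j)) (u j).
Let problem (x : J * rat * rat * rat) : {i : I & typeT rat (n i)} :=
  existT _ (projT1 x.1.1.1) (candidate (u x.1.1.1) x.1.1.2 x.1.2 x.2).

(* Three nested traversals of the thresholds; each level extends the context
by one number. *)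
Let best3 (x : J * rat * rat) := best [seq ans (problem (x, q)) | q <- thresholds (u x.1.1)].
Let best2 (x : J * rat) := best [seq best3 (x, p) | p <- thresholds (u x.1)].
Definition best_answer (j : J) : data := best [seq best2 (j, s) | s <- thresholds (u j)].

Hypothesis ans_ptime : ptime (fun it => typeT_valid (projT2 it))
  (fun it => code_typeT (code (projT1 it)) (projT2 it)) ans.

Lemma ptime_best_answer : ptime P instance best_answer.
Proof.
have inst : ptime P instance instance by exact: ptime_id.
apply: (ptime_best_map (out := best2) (ptime_thresholds inst)).
set P1 := fun js => _; pose a1 (x : J * rat) := Pair (instance x.1) (Atom x.2).
have a1_s := ptime_snd (ptime_id P1 a1).
have inst1 : ptime P1 a1 (fun x => code_robust (code (projT1 x.1)) (u x.1)).
  exact: ptime_fst (ptime_id _ _).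
apply: (ptime_best_map (out := best3) (ptime_thresholds inst1)).
set P2 := fun jsp => _; pose a2 (x : J * rat * rat) := Pair (a1 x.1) (Atom x.2).
have inst2 : ptime P2 a2 (fun x => code_robust (code (projT1 x.1.1)) (u x.1.1)).
  exact: ptime_fst (ptime_fst (ptime_id _ _)).
apply: (ptime_best_map (out := fun x => ans (problem x)) (ptime_thresholds inst2)).
set P3 := fun jspq => _; pose a3 (x : J * rat * rat * rat) := Pair (a2 x.1) (Atom x.2).
have inst3 : ptime P3 a3 (fun x => code_robust (code (projT1 x.1.1.1)) (u x.1.1.1)).
  exact: ptime_fst (ptime_fst (ptime_fst (ptime_id _ _))).
have q3 := ptime_snd (ptime_id P3 a3).
have p3 := ptime_snd (ptime_fst (ptime_id P3 a3)).
have s3 := ptime_snd (ptime_fst (ptime_fst (ptime_id P3 a3))).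
apply: ptime_comp (ptime_candidate inst3 s3 p3 q3) _.
apply: (ptime_reindex (h := problem)) ans_ptime => -[[[j s] p] q] [[[/= Pj sQ] _] _].
by apply: candidate_valid => //; apply: thresholds_ge0 sQ.
Qed.

Hypothesis ans_correct : forall it, typeT_valid (projT2 it) ->
  typeT_answer (N (projT1 it)) (projT2 it) (ans it).

Section Instance.
Variable j : J.
Hypothesis Pj : P j.
Let ur := real_budgeted R (u j).
Let Nj := N (projT1 j).

Let answered s p q : s \in thresholds (u j) ->
  typeT_answer Nj (candidate (u j) s p q) (ans (problem (j, s, p, q))).
Proof.
move=> sQ; apply: (ans_correct (it := problem (j, s, p, q))).
by apply: candidate_valid => //; apply: thresholds_ge0 sQ.
Qed.

Lemma best_answer_ind (A : data -> Prop) : A (Atom 0) ->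
  (forall s p q, s \in thresholds (u j) -> p \in thresholds (u j) ->
    q \in thresholds (u j) -> A (ans (problem (j, s, p, q)))) ->
  A (best_answer j).
Proof.
move=> A0 Aans; do 3![apply: best_ind => // ? ?].
exact: Aans.
Qed.

Lemma best_answer_le s p q : s \in thresholds (u j) -> p \in thresholds (u j) ->
  q \in thresholds (u j) ->
  (answer_value R (best_answer j)
     <= typeT_value Nj (real_typeT R (candidate (u j) s p q)))%E.
Proof.
move=> sQ pQ qQ; have isa s' p' q' : s' \in thresholds (u j) ->
    is_answer (ans (problem (j, s', p', q'))).
  by move=> /(answered p' q')/typeT_answer_value[].
have [_ <-] := typeT_answer_value (answered p q sQ).
apply: le_trans (best_le R (out := fun s => best2 (j, s)) _ sQ) _.
  by move=> s' s'Q; do 2![apply: (@best_ind is_answer) => // ? ?]; exact: isa.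
apply: le_trans (best_le R (out := fun p => best3 (j, s, p)) _ pQ) _.
  by move=> p' p'Q; apply: (@best_ind is_answer) => // ? ?; exact: isa.
by apply: (best_le R (out := fun q => ans (problem (j, s, p, q)))) => // ? ?; exact: isa.
Qed.

(** The value of the selected answer is at most that of every candidate, hence
at most the robust value.  Conversely the answer is a feasible solution of a
candidate, so its value is at least the worst case of its first-stage decision,
and that is at least the robust value.  All three agree. *)
Lemma best_answer_correct :
  robust_answer Nj (u j) (robust_report (best_answer j)).
Proof.
have urV : budgeted_valid ur by exact: real_budgeted_valid.
have le_best : (answer_value R (best_answer j) <= robust_value Nj ur)%E.
  apply: robust_value_ge => // s p q /mem_real_triples[s' [p' [q' [s'Q p'Q q'Q ->]]]].
  exact: best_answer_le.
pose attained r := r = Atom 0 \/ exists q (x : 'cV[rat]_(n (projT1 j))) z,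
  [/\ r = Pair (Atom q) (Pair (code_vec x) z), binary x
    & (worst_cost Nj ur (real_vec R x) <= (ratr q)%:E)%E].
have [r0|[q [x [z [rE bx xq]]]]] : attained (best_answer j).
- apply: best_answer_ind => [|s p q sQ pQ qQ]; first by left.
  have [[_ ->]|[v [x [y1 [y2 [-> xy costE _]]]]]] := answered p q sQ; first by left.
  right; exists v, x, (Pair (code_vec y1) (code_vec y2)); split=> //.
    by apply: (binary_real_vec (R := R)); case: xy => _ _ [].
  rewrite -costE real_candidate.
  have Q0 t : t \in thresholds (u j) -> 0 <= ratr t :> R.
    by move=> tQ; rewrite ler0q; apply: thresholds_ge0 tQ.
  by apply: worst_cost_le_candidate => //; exact: Q0.
- rewrite r0 in le_best *; left; split=> //.
  by apply/eqP; rewrite -leye_eq.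
- right; exists q, x; rewrite rE in le_best *; split=> //.
  + apply/eqP; rewrite eq_le xq /=; apply: le_trans le_best _.
    apply: ereal_inf_lbound; exists (real_vec R x) => //.
    by move=> i; rewrite mxE; case: (bx i) => ->; [left; rewrite rmorph0|right; rewrite rmorph1].
  + apply/eqP; rewrite eq_le le_best andbT; apply: le_trans xq.
    apply: ereal_inf_lbound; exists (real_vec R x) => //.
    by move=> i; rewrite mxE; case: (bx i) => ->; [left; rewrite rmorph0|right; rewrite rmorph1].
Qed.

End Instance.
End Solver.

Lemma typeT_poly_time_robust (R : realType) (I : Type) (n : I -> nat)
    (N : forall i, nominal R (n i)) (code : I -> data) :
  typeT_poly_time N code -> robust_poly_time N code.
Proof.
move=> /poly_time_ptime[ans [ansP ansC]].
apply: (ptime_poly_time (ans := fun j => robust_report (best_answer ans j))).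
  have b := ptime_best_answer ansP.
  apply: (ptime_if (ptime_op IsAtom b) (ptime_cst _ _ (Atom 0))).
  exact: ptime_pair (ptime_op Fst b) (ptime_op Fst (ptime_op Snd b)).
by move=> j; apply: best_answer_correct.
Qed.

Theorem theorem4 (R : realType) :
  (exists N1 N2 : nat -> nat,
    big_O N1 (fun n => n ^ 2)%N /\ big_O N2 (fun n => n ^ 3)%N /\
    forall (n : nat) (u : budgeted R n), budgeted_valid u ->
    exists (k1 k2 : nat) (p : 'I_k1 -> 'cV[R]_n * R) (t : 'I_k2 -> typeT R n),
      (k1 <= N1 n)%N /\ (k2 <= N2 n)%N /\
      (forall j, typeT_valid (t j)) /\
      forall N : nominal R n, is_integral (relaxation N) ->
        robust_value N u =
          Order.min (\big[Order.min/+oo%E]_(j < k1) nominal_value N (p j))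
                    (\big[Order.min/+oo%E]_(j < k2) typeT_value N (t j))) /\
  (forall (I : Type) (n : I -> nat) (N : forall i : I, nominal R (n i))
      (code : I -> data),
    (forall i : I, is_integral (relaxation (N i))) ->
    typeT_poly_time N code -> robust_poly_time N code).
Proof.
split; first exact: robust_value_reduction.
by move=> I n N code _; exact: typeT_poly_time_robust.
Qed.
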